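(* Let $N$ be a surface in a real $4$-dimensional Kaehlerian manifold $(M,g,J)$. Then $\nabla F=0$ if and only if $N$ is either a complex surface, or a totally real surface, or a minimal proper slant surface of $M$.
   Context: Manifolds are smooth and connected; ''surface'' means real $2$-dimensional submanifold, and a ''complex surface'' here is a surface with $J(T_xN)\subseteq T_xN$ for all $x$. $N$ is totally real if $J(T_xN)\subseteq T^\perp_xN$ for all $x$. For $X$ tangent to $N$, $FX$ is the normal component of $JX$; with $\nabla$ the Levi-Civita connection of $N$ and $D$ the normal connection, $(\nabla_XF)Y=D_X(FY)-F(\nabla_XY)$. $N$ is slant if the angle between $JX$ and $T_xN$ is a constant independent of $x\in N$ and nonzero $X\in T_xN$; a slant surface is proper if it is neither complex nor totally real. Minimal means the trace of the second fundamental form vanishes identically. *)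

(* Defs.v *)
From HB Require Import structures.
From mathcomp Require Import all_boot all_order all_algebra.
From mathcomp Require Import all_classical all_reals all_analysis.
Set Implicit Arguments.
Unset Strict Implicit.
Unset Printing Implicit Defensive.
Import Order.TTheory GRing.Theory Num.Theory.
Import numFieldNormedType.Exports.
Local Open Scope classical_set_scope.
Local Open Scope ring_scope.

(* Conventions: vectors of R^n are ROW vectors, so linear maps act on the right:
   the differential of f at u is [fun v => v *m jacobian f u], and an
   endomorphism field J sends v to [v *m J u]. *)

(* C^k on the open set U, by induction on k; f may be arbitrary outside U. *)
Fixpoint Ck_on (R : realType) (V W : normedModType R) (k : nat) (U : set V)
    (f : V -> W) : Prop :=
  match k with
  | 0 => forall x, U x -> {for x, continuous f}
  | k'.+1 => (forall x, U x -> differentiable f x)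
             /\ forall v : V, Ck_on k' U (fun x => 'D_v f x)
  end.

Definition smooth_on (R : realType) (V W : normedModType R) (U : set V)
    (f : V -> W) : Prop := forall k, Ck_on k U f.

(* [cmap] and [cinv] are total functions, meaningful on [cdom] and on
   [cmap @` cdom] respectively. *)
Record chart (R : realType) (n : nat) (T : topologicalType) := Chart {
  cdom : set T;
  cmap : T -> 'rV[R]_n;
  cinv : 'rV[R]_n -> T;
  cdom_open : open cdom;
  cimg_open : open (cmap @` cdom);
  cmap_continuous : forall p, cdom p -> {for p, continuous cmap};
  cinv_continuous : forall x, (cmap @` cdom) x -> {for x, continuous cinv};
  cmapK : forall p, cdom p -> cinv (cmap p) = p
}.

Definition cimg R n T (c : @chart R n T) : set 'rV[R]_n := cmap c @` cdom c.

(* The overlap is seen in the first chart. *)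
Definition overlap R n T (c d : @chart R n T) : set 'rV[R]_n :=
  cmap c @` (cdom c `&` cdom d).

Definition transition R n T (c d : @chart R n T) : 'rV[R]_n -> 'rV[R]_n :=
  fun x => cmap d (cinv c x).

(* The atlas need not be maximal. *)
Record manifold (R : realType) (n : nat) := Manifold {
  carrier :> topologicalType;
  atlas : set (chart R n carrier);
  carrier_hausdorff : hausdorff_space carrier;
  carrier_second_countable : @second_countable carrier;
  carrier_connected : connected [set: carrier];
  atlas_cover : forall p : carrier, exists2 c, atlas c & cdom c p;
  transition_smooth : forall c d, atlas c -> atlas d ->
    smooth_on (overlap c d) (transition c d)
}.

Definition basis_vec (R : realType) n (i : 'I_n) : 'rV[R]_n := delta_mx 0 i.

Definition inner (R : realType) n (G : 'M[R]_n) (v w : 'rV[R]_n) : R :=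
  (v *m G *m w^T) 0 0.

Definition gnorm (R : realType) n (G : 'M[R]_n) (v : 'rV[R]_n) : R :=
  Num.sqrt (inner G v v).

(* Gamma^k_{ij}, with arguments in the order k i j. *)
Definition christoffel (R : realType) n (G : 'rV[R]_n -> 'M[R]_n)
    (x : 'rV[R]_n) (k i j : 'I_n) : R :=
  2^-1 * \sum_(l < n) invmx (G x) k l *
    ('D_(basis_vec R i) (fun y => G y j l) x
     + 'D_(basis_vec R j) (fun y => G y i l) x
     - 'D_(basis_vec R l) (fun y => G y i j) x).

Definition christoffel_form (R : realType) n (G : 'rV[R]_n -> 'M[R]_n)
    (x v w : 'rV[R]_n) : 'rV[R]_n :=
  \row_k \sum_(i < n) \sum_(j < n) v 0 i * w 0 j * christoffel G x k i j.

Definition nabla (R : realType) n (G : 'rV[R]_n -> 'M[R]_n)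
    (X Y : 'rV[R]_n -> 'rV[R]_n) (x : 'rV[R]_n) : 'rV[R]_n :=
  'D_(X x) Y x + christoffel_form G x (X x) (Y x).

(* A tensor field is a family of components, one for each chart of the atlas,
   obeying the transformation law of its type under changes of coordinates. *)
Definition is_riemannian (R : realType) n (M : manifold R n)
    (g : chart R n M -> 'rV[R]_n -> 'M[R]_n) : Prop :=
  [/\ forall c, atlas c -> smooth_on (cimg c) (g c),
      forall c x, atlas c -> cimg c x -> (g c x)^T = g c x,
      forall c x (v : 'rV[R]_n), atlas c -> cimg c x -> v != 0 ->
        0 < inner (g c x) v v &
      forall c d x, atlas c -> atlas d -> overlap c d x ->
        let A := jacobian (transition c d) x in
        g c x = A *m g d (transition c d x) *m A^T].

Definition is_almost_complex (R : realType) n (M : manifold R n)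
    (J : chart R n M -> 'rV[R]_n -> 'M[R]_n) : Prop :=
  [/\ forall c, atlas c -> smooth_on (cimg c) (J c),
      forall c x, atlas c -> cimg c x -> J c x *m J c x = - 1%:M &
      forall c d x, atlas c -> atlas d -> overlap c d x ->
        let A := jacobian (transition c d) x in
        J c x *m A = A *m J d (transition c d x)].

(* Kaehlerian: almost Hermitian with J parallel, i.e. nabla_X (JY) = J (nabla_X Y). *)
Record kaehler (R : realType) n (M : manifold R n) := Kaehler {
  kmetric : chart R n M -> 'rV[R]_n -> 'M[R]_n;
  kJ : chart R n M -> 'rV[R]_n -> 'M[R]_n;
  kmetric_riemannian : is_riemannian kmetric;
  kJ_almost_complex : is_almost_complex kJ;
  k_hermitian : forall c x (v w : 'rV[R]_n), atlas c -> cimg c x ->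
    inner (kmetric c x) (v *m kJ c x) (w *m kJ c x) = inner (kmetric c x) v w;
  kJ_parallel : forall c (U : set 'rV[R]_n) (X Y : 'rV[R]_n -> 'rV[R]_n),
    atlas c -> open U -> U `<=` cimg c -> smooth_on U X -> smooth_on U Y ->
    forall x, U x ->
      nabla (kmetric c) X (fun y => Y y *m kJ c y) x
      = nabla (kmetric c) X Y x *m kJ c x
}.

Definition local_dom (R : realType) m n (N : manifold R m) (M : manifold R n)
    (phi : N -> M) (c : chart R m N) (d : chart R n M) : set 'rV[R]_m :=
  cmap c @` (cdom c `&` phi @^-1` cdom d).

Definition local_rep (R : realType) m n (N : manifold R m) (M : manifold R n)
    (phi : N -> M) (c : chart R m N) (d : chart R n M) :
    'rV[R]_m -> 'rV[R]_n :=
  fun u => cmap d (phi (cinv c u)).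

(* An immersed submanifold carries the induced metric; phi need not be
   injective, so embedded submanifolds are a particular case. *)
Definition is_immersion (R : realType) m n (N : manifold R m)
    (M : manifold R n) (phi : N -> M) : Prop :=
  continuous phi /\
  forall c d, atlas c -> atlas d ->
    smooth_on (local_dom phi c d) (local_rep phi c d) /\
    forall u, local_dom phi c d u -> row_free (jacobian (local_rep phi c d) u).

Section LocalImmersion.
(* An immersion f of an open set of R^m into an open set of R^n carrying the
   metric G and the endomorphism field J; fields tangent to the submanifold are
   given by their coordinates in R^m, fields along f by values in R^n. *)
Context {R : realType} {m n : nat}.
Context (f : 'rV[R]_m -> 'rV[R]_n) (G J : 'rV[R]_n -> 'M[R]_n).
Implicit Types (u : 'rV[R]_m) (X Y : 'rV[R]_m -> 'rV[R]_m).

(* The row spaces of these two matrices are the tangent space and its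
   G-orthogonal complement, the normal space. *)
Definition tangent_sp u : 'M[R]_n := <<jacobian f u>>%MS.
Definition normal_sp u : 'M[R]_n := kermx (G (f u) *m (jacobian f u)^T).

Definition tangent_part u (v : 'rV[R]_n) : 'rV[R]_n :=
  v *m proj_mx (tangent_sp u) (normal_sp u).
Definition normal_part u (v : 'rV[R]_n) : 'rV[R]_n :=
  v *m proj_mx (normal_sp u) (tangent_sp u).

Definition push u (x : 'rV[R]_m) : 'rV[R]_n := x *m jacobian f u.

Definition induced_metric u : 'M[R]_m :=
  jacobian f u *m G (f u) *m (jacobian f u)^T.

Definition nabla_along X (xi : 'rV[R]_m -> 'rV[R]_n) u : 'rV[R]_n :=
  'D_(X u) xi u + christoffel_form G (f u) (push u (X u)) (xi u).

Definition second_form X Y u : 'rV[R]_n :=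
  normal_part u (nabla_along X (fun w => push w (Y w)) u).

Definition normal_connection X (xi : 'rV[R]_m -> 'rV[R]_n) u : 'rV[R]_n :=
  normal_part u (nabla_along X xi u).

Definition trace_second_form u : 'rV[R]_n :=
  \sum_(i < m) \sum_(j < m) invmx (induced_metric u) i j *:
    second_form (fun=> basis_vec R i) (fun=> basis_vec R j) u.

Definition Fmap u (x : 'rV[R]_m) : 'rV[R]_n :=
  normal_part u (push u x *m J (f u)).

Definition nablaF X Y u : 'rV[R]_n :=
  normal_connection X (fun w => Fmap w (Y w)) u
  - Fmap u (nabla induced_metric X Y u).

(* Angle between J x and the tangent space: the angle between J x and its
   orthogonal projection. *)
Definition wirtinger_angle u (x : 'rV[R]_m) : R :=
  let Jx := push u x *m J (f u) in
  acos (gnorm (G (f u)) (tangent_part u Jx) / gnorm (G (f u)) Jx).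

End LocalImmersion.

Section Submanifold.
Context {R : realType} {m n : nat} {M : manifold R n} (K : kaehler M).
Context {N : manifold R m} (phi : N -> M).

Definition F_parallel : Prop :=
  forall c d (U : set 'rV[R]_m) (X Y : 'rV[R]_m -> 'rV[R]_m),
    atlas c -> atlas d -> open U -> U `<=` local_dom phi c d ->
    smooth_on U X -> smooth_on U Y -> forall u, U u ->
    nablaF (local_rep phi c d) (kmetric K d) (kJ K d) X Y u = 0.

Definition complex_submanifold : Prop :=
  forall c d u (v : 'rV[R]_n), atlas c -> atlas d -> local_dom phi c d u ->
    let f := local_rep phi c d in
    (v <= tangent_sp f u)%MS -> (v *m kJ K d (f u) <= tangent_sp f u)%MS.

Definition totally_real : Prop :=
  forall c d u (v : 'rV[R]_n), atlas c -> atlas d -> local_dom phi c d u ->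
    let f := local_rep phi c d in
    (v <= tangent_sp f u)%MS ->
    (v *m kJ K d (f u) <= normal_sp f (kmetric K d) u)%MS.

Definition slant : Prop :=
  exists theta : R, forall c d u (x : 'rV[R]_m),
    atlas c -> atlas d -> local_dom phi c d u -> x != 0 ->
    wirtinger_angle (local_rep phi c d) (kmetric K d) (kJ K d) u x = theta.

Definition proper_slant : Prop :=
  [/\ slant, ~ complex_submanifold & ~ totally_real].

Definition minimal : Prop :=
  forall c d u, atlas c -> atlas d -> local_dom phi c d u ->
    trace_second_form (local_rep phi c d) (kmetric K d) u = 0.

End Submanifold.

(* Main.v *)
(* Write [P] for the jacobian of a local expression of the immersion, [g] for
   the induced metric, [om] for the pullback of the Kaehler form, and
   [B_x] for the second fundamental form in the direction [x], as a matrix.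
   Metric compatibility, [nabla J = 0], the symmetry of second derivatives and
   Gauss' formula give [(nabla_x F) y = y *m (B_x J - T B_x)^normal].  In a
   [g]-orthonormal frame [e1, e2] one has [T e1 = c e2] and [T e2 = - c e1],
   while [F e1] and [F e2] are orthogonal normal vectors of squared length
   [1 - c^2]; in dimension 4 they span the normal space when [c^2 <> 1].  Against them, with
   [a_jk(x) = <B_x e_j, F e_k>], the equation [nabla F = 0] reads
   [c (a_21 - a_12) = 0] and [c (a_11 + a_22) = 0], and the derivative of the
   chart-independent function [c^2 = om_12^2 / det g] along [x] is
   [2 c (a_21 - a_12)].  So [nabla F = 0] makes [c^2] constant, by connectedness:
   the value 1 means complex, 0 means totally real, and otherwise the symmetry
   of the second fundamental form turns the two equations into minimality.
   Conversely, constancy of [c^2] and minimality give the two equations back. *)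

Require Import Defs.
From mathcomp Require Import all_boot all_order all_algebra perm.
From mathcomp Require Import all_classical all_reals all_analysis.
From mathcomp Require Import ring lra.

Set Implicit Arguments.
Unset Strict Implicit.
Unset Printing Implicit Defensive.
Import Order.TTheory GRing.Theory Num.Theory.
Import numFieldNormedType.Exports.
Local Open Scope classical_set_scope.
Local Open Scope ring_scope.

(** * Symmetry of second derivatives *)

Lemma is_derive_line (R : realType) (V W : normedModType R) (f : V -> W) (x v : V)
    (t : R) : derivable f (x + t *: v) v ->
  is_derive t 1 (fun s : R => f (x + s *: v)) ('D_v f (x + t *: v)).
Proof.
pose r (h : R) := h^-1 *: (f (h *: v + (x + t *: v)) - f (x + t *: v)).
have rE : (fun h => h^-1 *: (((fun s : R => f (x + s *: v)) \o shift t) (h *: 1)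
    - f (x + t *: v))) = r.
  apply/funext => h; rewrite /r /=.
  by rewrite [h *: 1]mulr1 scalerDl addrCA.
move=> dfx; split; first by rewrite /derivable rE.
by rewrite /derive rE.
Qed.

Lemma MVT_line (R : realType) (V : normedModType R) (f : V -> R) (x v : V)
    (h : R) : 0 < h ->
  (forall t, 0 <= t <= h -> derivable f (x + t *: v) v) ->
  exists2 t, 0 < t < h & f (x + h *: v) - f x = h * 'D_v f (x + t *: v).
Proof.
move=> h0 df.
have /(MVT h0) [] : forall t, t \in `]0, h[%R ->
    is_derive t 1 (fun s : R => f (x + s *: v)) ('D_v f (x + t *: v)).
  move=> t; rewrite in_itv /= => /andP[t0 th].
  by apply: is_derive_line; apply: df; rewrite !ltW.
- apply: derivable_within_continuous => t; rewrite in_itv /= => tI.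
  by have [] := is_derive_line (df _ tI).
- move=> t; rewrite in_itv /= => tI.
  by rewrite scale0r addr0 subr0 mulrC => E; exists t.
Qed.

Lemma near_parallelogram (R : realType) (V : normedModType R) (v w x : V)
    (A : set V) : nbhs x A ->
  exists2 h : R, 0 < h &
    forall s t, 0 <= s <= h -> 0 <= t <= h -> A (x + s *: v + t *: w).
Proof.
move=> /nbhs_ballP[e /= e0 eA].
have k0 : 0 < `|v| + `|w| + 1 by rewrite ltr_wpDl ?ltr01 ?addr_ge0.
(* Halving the radius makes the final bound strict; the added 1 keeps the denominator positive when
   [v] and [w] both vanish. *)
exists (e / 2 / (`|v| + `|w| + 1)); first by rewrite !divr_gt0.
move=> s t /andP[s0 sh] /andP[t0 th]; apply: eA.
rewrite -ball_normE /= -addrA opprD addrA subrr add0r normrN.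
rewrite (le_lt_trans (ler_normD _ _))// !normrZ !ger0_norm//.
have /le_lt_trans : s * `|v| + t * `|w| <= e / 2 / (`|v| + `|w| + 1) * (`|v| + `|w| + 1).
  rewrite mulrDr mulr1 mulrDr -addrA lerD ?ler_wpM2r// ler_wpDr ?ler_wpM2r//.
  by rewrite ltW// !divr_gt0.
by apply; rewrite divfK ?gt_eqF// ltr_pdivrMr// ltr_pMr// ltr1n.
Qed.

Section SymmetryOfSecondDerivatives.
Context {R : realType} {V : normedModType R}.
Implicit Types (f : V -> R) (x v w : V).

(** Two mean value theorems: along [v] for the increment [k] of [f] by [h *: w], then along [w] for
    ['D_v f]. *)
Let second_difference f x v w (h : R) : 0 < h ->
  (forall s t, 0 <= s <= h -> 0 <= t <= h -> derivable f (x + s *: v + t *: w) v) ->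
  (forall s t, 0 <= s <= h -> 0 <= t <= h ->
    derivable ('D_v f) (x + s *: v + t *: w) w) ->
  exists s t, [/\ 0 <= s <= h, 0 <= t <= h &
    f (x + h *: v + h *: w) - f (x + h *: v) - (f (x + h *: w) - f x)
    = h * h * 'D_w ('D_v f) (x + s *: v + t *: w)].
Proof.
move=> h0 dv dvw.
have hI : 0 <= h <= h by rewrite lexx ltW.
have zI : 0 <= (0 : R) <= h by rewrite lexx ltW.
pose k y := f (y + h *: w) - f y.
have dk t : 0 <= t <= h -> is_derive (x + t *: v) v k
    ('D_v f (x + t *: v + h *: w) - 'D_v f (x + t *: v)).
  move=> tI; apply: is_deriveB; last first.
    by apply: derivableP; have := dv _ _ tI zI; rewrite scale0r addr0.
  have := dv _ _ tI hI.
  pose r (e : R) := e^-1 *: (f (e *: v + (x + t *: v + h *: w))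
    - f (x + t *: v + h *: w)).
  have rE : (fun e => e^-1 *: (((fun y => f (y + h *: w)) \o shift (x + t *: v))
     (e *: v) - f (x + t *: v + h *: w))) = r.
    by apply/funext => e; rewrite /r /= !addrA.
  move=> dfx; split; first by rewrite /derivable rE.
  by rewrite /derive rE.
have [s /andP[s0 sh] ks] : exists2 s, 0 < s < h &
    k (x + h *: v) - k x = h * 'D_v k (x + s *: v).
  by apply: (@MVT_line _ _ k x v h h0) => t /dk [].
have sI : 0 <= s <= h by rewrite !ltW.
have [t /andP[t0 th] kt] : exists2 t, 0 < t < h &
   'D_v f (x + s *: v + h *: w) - 'D_v f (x + s *: v) =
   h * 'D_w ('D_v f) (x + s *: v + t *: w).
  by apply: (@MVT_line _ _ ('D_v f) (x + s *: v) w h h0) => t tI; exact: dvw.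
exists s, t; split => //; first by rewrite !ltW.
have [_ dks] := dk _ sI.
by rewrite -mulrA -kt -dks -ks.
Qed.

(** Each order of differentiation has its own mean value point, so equality is only known at two
    different points near [x]; continuity brings both to [x]. *)
Let eq_at_limit (F F' : V -> R) x :
  {for x, continuous F} -> {for x, continuous F'} ->
  (forall A, nbhs x A -> exists y y', [/\ A y, A y' & F y = F' y']) ->
  F x = F' x.
Proof.
move=> Fx F'x FF'; apply/eqP; rewrite -subr_eq0 -normr_le0.
apply/ler_addgt0Pl => e e0; rewrite addr0.
have e20 : 0 < e / 2 by rewrite divr_gt0.
move/cvgrPdist_lt : Fx => /(_ _ e20) nF; move/cvgrPdist_lt : F'x => /(_ _ e20) nF'.
have [y [y' [[yF _] [_ y'F'] E]]] := FF' _ (filterI nF nF').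
rewrite -(subrKA (F y)) [leRHS](splitr e).
apply: le_trans (ler_normD _ _) _; apply: lerD; first exact: ltW yF.
by rewrite E distrC; exact: ltW y'F'.
Qed.

(** The second difference over a small parallelogram is symmetric in [v] and [w]; divided by [h * h]
    it is a value near [x] of either mixed derivative. *)
Lemma derive_swap f (U : set V) x v w : open U -> U x ->
  (forall y, U y -> derivable f y v) -> (forall y, U y -> derivable f y w) ->
  (forall y, U y -> derivable ('D_v f) y w) ->
  (forall y, U y -> derivable ('D_w f) y v) ->
  {for x, continuous ('D_w ('D_v f))} -> {for x, continuous ('D_v ('D_w f))} ->
  'D_w ('D_v f) x = 'D_v ('D_w f) x.
Proof.
move=> oU Ux dv dw dvw dwv cvw cwv; apply: eq_at_limit cvw cwv _ => A nA.
have [h h0 hA] := near_parallelogram v w (filterI (open_nbhs_nbhs (conj oU Ux)) nA).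
have [||s [t [sI tI E]]] := @second_difference f x v w h h0.
- by move=> s t sI tI; apply: dv; have [] := hA _ _ sI tI.
- by move=> s t sI tI; apply: dvw; have [] := hA _ _ sI tI.
have [||s' [t' [sI' tI' E']]] := @second_difference f x w v h h0.
- by move=> s' t' sI' tI'; apply: dw; rewrite addrAC; have [] := hA _ _ tI' sI'.
- by move=> s' t' sI' tI'; apply: dwv; rewrite addrAC; have [] := hA _ _ tI' sI'.
exists (x + s *: v + t *: w), (x + t' *: v + s' *: w); split.
- by have [] := hA _ _ sI tI.
- by have [] := hA _ _ tI' sI'.
have hh : h * h != 0 by rewrite mulf_neq0 ?gt_eqF.
rewrite [x + h *: w + h *: v]addrAC [x + s' *: w + t' *: v]addrAC in E'.
have swap (a b c d : R) : a - b - (c - d) = a - c - (b - d) by ring.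
by apply: (mulfI hh); rewrite -[LHS]E -[RHS]E'; exact: swap.
Qed.

End SymmetryOfSecondDerivatives.

Lemma derive0_near_cst (R : realType) (V : normedModType R) (f : V -> R)
    (U : set V) (x : V) : open U -> U x ->
  (forall y v, U y -> is_derive y v f 0) -> \forall y \near x, f y = f x.
Proof.
move=> oU Ux df.
have /nbhs_ballP[e /= e0 eU] := open_nbhs_nbhs (conj oU Ux).
apply/nbhs_ballP; exists e => //= y xy.
have lU t : 0 <= t <= 1 -> U (x + t *: (y - x)).
  move=> /andP[t0 t1]; apply: eU; move: xy; rewrite -!ball_normE /= => xy.
  rewrite opprD addrA subrr add0r normrN normrZ ger0_norm//.
  by rewrite (le_lt_trans _ xy)// distrC ler_piMl.
have [||t /andP[t0 t1]] := @MVT_line _ _ f x (y - x) 1.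
- exact: ltr01.
- by move=> t /lU /(df _ (y - x)) [].
have /lU /(df _ (y - x)) [_ ->] : 0 <= t <= 1 by rewrite !ltW.
by rewrite scale1r subrKC mulr0 => /eqP; rewrite subr_eq0 => /eqP.
Qed.

(** * Derivatives of matrix-valued functions *)

Section MatrixCalculus.
Context {R : realType} {V : normedModType R}.
Implicit Types (x v : V).

Lemma is_derive_mx m n (A : V -> 'M[R]_(m, n)) (dA : 'M[R]_(m, n)) x v :
  (forall i j, is_derive x v (fun y => A y i j) (dA i j)) -> is_derive x v A dA.
Proof.
move=> dAij.
have dAx : derivable A x v by apply/derivable_mxP => i j; have [] := dAij i j.
split=> //; rewrite (derive_mx dAx); apply/matrixP => i j.
by rewrite mxE; have [] := dAij i j.
Qed.

Lemma is_derive_coord m n (A : V -> 'M[R]_(m, n)) dA x v i j :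
  is_derive x v A dA -> is_derive x v (fun y => A y i j) (dA i j).
Proof.
case=> dAx <-; split; first by move/derivable_mxP : dAx.
by rewrite (derive_mx dAx) mxE.
Qed.

Lemma is_derive_mulmx m n p (A : V -> 'M[R]_(m, n)) (B : V -> 'M[R]_(n, p))
    dA dB x v : is_derive x v A dA -> is_derive x v B dB ->
  is_derive x v (fun y => A y *m B y) (dA *m B x + A x *m dB).
Proof.
move=> DA DB; apply: is_derive_mx => i j.
have -> : (fun y => (A y *m B y) i j) =
    \sum_k ((fun y => A y i k) * (fun y => B y k j)).
  by apply/funext => y; rewrite mxE fct_sumE.
rewrite !mxE -big_split /=.
apply: is_derive_sum => k.
apply: is_derive_eq (is_deriveM (is_derive_coord i k DA) (is_derive_coord k j DB)) _.
by rewrite addrC /GRing.scale /= [B x k j * _]mulrC.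
Qed.

Lemma is_derive_trmx m n (A : V -> 'M[R]_(m, n)) dA x v :
  is_derive x v A dA -> is_derive x v (fun y => (A y)^T) dA^T.
Proof.
move=> DA; apply: is_derive_mx => i j; rewrite mxE.
have -> : (fun y => (A y)^T i j) = (fun y => A y j i).
  by apply/funext => y; rewrite mxE.
exact: is_derive_coord.
Qed.

Lemma is_derive_mulmxl m n p (C : 'M[R]_(m, n)) (A : V -> 'M[R]_(n, p)) dA x v :
  is_derive x v A dA -> is_derive x v (fun y => C *m A y) (C *m dA).
Proof.
move=> DA; have := is_derive_mulmx (is_derive_cst C x v) DA.
by rewrite mul0mx add0r.
Qed.

Lemma is_derive_mulmxr m n p (A : V -> 'M[R]_(m, n)) (C : 'M[R]_(n, p)) dA x v :
  is_derive x v A dA -> is_derive x v (fun y => A y *m C) (dA *m C).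
Proof.
move=> DA; have := is_derive_mulmx DA (is_derive_cst C x v).
by rewrite mulmx0 addr0.
Qed.

Lemma derivable_prod (I : Type) (r : seq I) (F : I -> V -> R) x v :
  (forall i, derivable (F i) x v) -> derivable (fun y => \prod_(i <- r) F i y) x v.
Proof.
move=> dF; elim: r => [|i r IH].
  under [X in derivable X]eq_fun do rewrite big_nil.
  exact: derivable_cst.
under [X in derivable X]eq_fun do rewrite big_cons.
exact: derivableM.
Qed.

Lemma derivable_det n (A : V -> 'M[R]_n) x v :
  derivable A x v -> derivable (fun y => \det (A y)) x v.
Proof.
move=> /derivable_mxP dA; rewrite /determinant.
have -> : (fun y => \sum_(s : 'S_n) (-1) ^+ s * \prod_i A y i (s i)) =
   \sum_(s : 'S_n) ((-1) ^+ s *: (fun y => \prod_i A y i (s i))).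
  by apply/funext => y; rewrite fct_sumE.
elim/big_ind : _ => [|F G dF dG|s _]; first exact: derivable_cst.
- exact: derivableD.
- by apply: derivableZ; apply: derivable_prod => i; exact: dA.
Qed.

Lemma derivable_adjugate n (A : V -> 'M[R]_n) x v :
  derivable A x v -> derivable (fun y => \adj (A y)) x v.
Proof.
move=> /derivable_mxP dA; apply/derivable_mxP => i j.
under [X in derivable X]eq_fun do rewrite mxE /cofactor.
apply: (@derivableZ _ _ _ (fun y => \det (row' j (col' i (A y))))).
apply: derivable_det; apply/derivable_mxP => k l.
by under [X in derivable X]eq_fun do rewrite !mxE; exact: dA.
Qed.

Lemma derivable_invmx n (A : V -> 'M[R]_n) x v :
  (\forall y \near x, A y \in unitmx) -> derivable A x v ->
  derivable (fun y => invmx (A y)) x v.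
Proof.
move=> Au dA.
(* [invmx] returns its argument on singular matrices, so the cofactor formula is only claimed near
   [x]. *)
apply: (@near_eq_derivable _ _ _ (fun y => (\det (A y))^-1 *: \adj (A y))).
  by apply: filterS Au => y Ay; rewrite /invmx Ay.
apply/derivable_mxP => i j.
under [X in derivable X]eq_fun do rewrite mxE.
apply: derivableM.
- apply: derivableV; last exact: derivable_det.
  by have := nbhs_singleton Au; rewrite unitmxE unitfE.
- by have /derivable_mxP := derivable_adjugate dA.
Qed.

End MatrixCalculus.

Lemma is_derive_comp (R : realType) (U V W : normedModType R) (f : U -> V)
    (g : V -> W) x v : differentiable f x -> differentiable g (f x) ->
  is_derive x v (fun y => g (f y)) ('D_('D_v f x) g (f x)).
Proof.
move=> df dg; have dgf := differentiable_comp df dg.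
split; first exact: diff_derivable.
by rewrite (deriveE _ dgf) (diff_comp df dg) /= !deriveE.
Qed.

Lemma smooth_differentiable (R : realType) (V W : normedModType R) (U : set V)
    (f : V -> W) x : smooth_on U f -> U x -> differentiable f x.
Proof. by move=> sf Ux; have [df _] := sf 1%N; exact: df x Ux. Qed.

Lemma smooth_derive (R : realType) (V W : normedModType R) (U : set V)
    (f : V -> W) v : smooth_on U f -> smooth_on U ('D_v f).
Proof. by move=> sf k; have [_ sfk] := sf k.+1; exact: sfk. Qed.

Lemma smooth_cst (R : realType) (V W : normedModType R) (U : set V) (a : W) :
  smooth_on U (fun _ : V => a).
Proof.
move=> k; elim: k a => [|k IH] a; first by move=> x _; exact: cvg_cst.
split=> [x _|v]; first exact: differentiable_cst.
have -> : (fun x => 'D_v (fun=> a) x) = (fun _ : V => 0) :> (V -> W).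
  by apply/funext => x; exact: derive_cst.
exact: IH.
Qed.

(** Reduction to the real-valued entries. Taking entries is known to commute with differentiation
    only on [U], hence the identifications near a point. *)
Lemma smooth_derive_swap (R : realType) (V : normedModType R) m n (U : set V)
    (f : V -> 'M[R]_(m, n)) x v w : open U -> U x -> smooth_on U f ->
  'D_w ('D_v f) x = 'D_v ('D_w f) x.
Proof.
move=> oU Ux sf; pose fc i j y := f y i j.
have dfc y a i j : U y -> is_derive y a (fc i j) ('D_a f y i j).
  move=> Uy; apply: is_derive_coord; apply: derivableP; apply: diff_derivable.
  exact: smooth_differentiable sf Uy.
have near_ki_dom a i j y : U y -> \near y, 'D_a f y i j = 'D_a (fc i j) y.
  move=> Uy; apply: filterS (open_nbhs_nbhs (conj oU Uy)) => z /dfc-/(_ a i j).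
  by case.
have ddfc y a b i j : U y -> is_derive y b ('D_a (fc i j)) ('D_b ('D_a f) y i j).
  move=> Uy; apply: near_eq_is_derive (near_ki_dom a i j y Uy) _.
  apply: is_derive_coord; apply: derivableP; apply: diff_derivable.
  exact: smooth_differentiable (smooth_derive a sf) Uy.
have cddfc a b i j : {for x, continuous ('D_b ('D_a (fc i j)))}.
  have cD : {for x, continuous ('D_b ('D_a f))}.
    exact: (smooth_derive b (smooth_derive a sf) 0%N).
  have E : \near x, 'D_b ('D_a f) x i j = 'D_b ('D_a (fc i j)) x.
    by apply: filterS (open_nbhs_nbhs (conj oU Ux)) => z /ddfc-/(_ a b i j) [].
  have C : {for x, continuous (fun y => 'D_b ('D_a f) y i j)}.
    apply: (@continuous_comp _ _ _ ('D_b ('D_a f)) (fun M : 'M[R]_(m, n) => M i j)).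
      exact: cD.
    exact: coord_continuous.
  change ('D_b ('D_a (fc i j)) @ x --> 'D_b ('D_a (fc i j)) x).
  by rewrite -(nbhs_singleton E); apply: cvg_trans C; exact: near_eq_cvg.
apply/matrixP => i j.
have [_ Evw] := ddfc x v w i j Ux; have [_ Ewv] := ddfc x w v i j Ux.
rewrite -[LHS]Evw -[RHS]Ewv.
apply: (@derive_swap _ _ (fc i j) U x v w oU Ux); try exact: cddfc.
- by move=> y Uy; have [] := dfc y v i j Uy.
- by move=> y Uy; have [] := dfc y w i j Uy.
- by move=> y Uy; have [] := ddfc y v w i j Uy.
- by move=> y Uy; have [] := ddfc y w v i j Uy.
Qed.

(** * Jacobians and their derivatives *)

Section Jacobian.
Context {R : realType} {m n : nat}.
Implicit Types (f : 'rV[R]_m -> 'rV[R]_n) (U : set 'rV[R]_m) (u x y : 'rV[R]_m).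

Lemma derive_push f u x : differentiable f u -> 'D_x f u = push f u x.
Proof. exact: deriveEjacobian. Qed.

Lemma near_derive_push f U u x : open U -> smooth_on U f -> U u ->
  \forall w \near u, push f w x = 'D_x f w.
Proof.
move=> oU sf Uu; apply: filterS (open_nbhs_nbhs (conj oU Uu)) => w Uw.
by rewrite derive_push//; exact: smooth_differentiable sf Uw.
Qed.

Lemma derivable_jacobian f U u x : open U -> smooth_on U f -> U u ->
  derivable (jacobian f) u x.
Proof.
move=> oU sf Uu; apply/derivable_mxP => i j.
pose h (w : 'rV[R]_m) := 'D_(basis_vec R i) f w 0 j.
apply: (@near_eq_derivable _ _ _ h); last first.
  have dDf := smooth_differentiable (smooth_derive (basis_vec R i) sf) Uu.
  by have /derivable_mxP := diff_derivable (v := x) dDf; exact.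
apply: filterS (near_derive_push (basis_vec R i) oU sf Uu) => w E.
by rewrite /h -E /push /basis_vec -rowE mxE.
Qed.

(** Near [u], [y *m jacobian f] is ['D_y f], so the two sides are mixed second derivatives of [f] in
    opposite orders. *)
Lemma derive_jacobian_sym f U u x y : open U -> smooth_on U f -> U u ->
  y *m 'D_x (jacobian f) u = x *m 'D_y (jacobian f) u.
Proof.
move=> oU sf Uu.
have E a b : a *m 'D_b (jacobian f) u = 'D_b ('D_a f) u.
  have /derivableP dP := derivable_jacobian (x := b) oU sf Uu.
  have [_ <-] := is_derive_mulmxl a dP.
  by apply: near_eq_derive; exact: (near_derive_push a oU sf Uu).
by rewrite !E; exact: smooth_derive_swap oU Uu sf.
Qed.

End Jacobian.

(** * The Levi-Civita connection in coordinates *)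

Section Christoffel.
Context {R : realType} {n : nat}.
Implicit Types (G : 'rV[R]_n -> 'M[R]_n) (p v w : 'rV[R]_n).

(* The connection matrix: [nabla_v w = 'D_v w + w *m christoffel_mx G p v]. *)
Definition christoffel_mx G p v : 'M[R]_n :=
  \matrix_(j, k) \sum_i v 0 i * christoffel G p k i j.

Lemma christoffel_formE G p v w :
  christoffel_form G p v w = w *m christoffel_mx G p v.
Proof.
apply/rowP => k; rewrite !mxE exchange_big /=; apply: eq_bigr => j _.
rewrite mxE big_distrr /=; apply: eq_bigr => i _; ring.
Qed.

(** The Christoffel symbols of the first kind. *)
Definition christoffel1 G p (i j l : 'I_n) : R :=
  2^-1 * ('D_(basis_vec R i) (fun y => G y j l) p
          + 'D_(basis_vec R j) (fun y => G y i l) p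
          - 'D_(basis_vec R l) (fun y => G y i j) p).

Lemma christoffel_mxM G p v : (G p)^T = G p -> G p \in unitmx ->
  christoffel_mx G p v *m G p
  = \matrix_(j, l) \sum_i v 0 i * christoffel1 G p i j l.
Proof.
move=> Gs Gu; set C := RHS.
suff -> : christoffel_mx G p v = C *m (invmx (G p))^T.
  by rewrite -mulmxA trmx_inv Gs mulVmx// mulmx1.
apply/matrixP => j k; rewrite !mxE.
under [RHS]eq_bigr => l _ do rewrite !mxE big_distrl /=.
rewrite exchange_big /=; apply: eq_bigr => i _.
rewrite /christoffel !big_distrr /=; apply: eq_bigr => l _.
rewrite /christoffel1; ring.
Qed.

(** Uniqueness of the Levi-Civita connection: the [K i] act as connection matrices with lowered
    index, metric by the condition on derivatives and torsion-free by the condition on rows, and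
    Koszul's alternating sum gives them back. *)
Lemma christoffel_mx_koszul G p (K : 'I_n -> 'M[R]_n) v :
  (G p)^T = G p -> G p \in unitmx ->
  (forall i, is_derive p (basis_vec R i) G (K i + (K i)^T)) ->
  (forall i j, row j (K i) = row i (K j)) ->
  christoffel_mx G p v *m G p = \sum_i v 0 i *: K i.
Proof.
move=> Gs Gu DG Ks; rewrite christoffel_mxM//; apply/matrixP => j l.
rewrite mxE summxE; apply: eq_bigr => i _; rewrite mxE; congr (_ * _).
have DGE a b c : 'D_(basis_vec R a) (fun y => G y b c) p = K a b c + K a c b.
  by have [_ ->] := is_derive_coord b c (DG a); rewrite !mxE.
have KE a b c : K a b c = K b a c by have /rowP/(_ c) := Ks a b; rewrite !mxE.
rewrite /christoffel1 !DGE (KE j i l) (KE l i j) (KE l j i); lra.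
Qed.

Section Metric.
Variables (G : 'rV[R]_n -> 'M[R]_n) (p : 'rV[R]_n).
Hypothesis Gd : differentiable G p.
Hypothesis Gs : \forall y \near p, (G y)^T = G y.
Hypothesis Gu : G p \in unitmx.

Let derive_entryC v i j : 'D_v (fun y => G y i j) p = 'D_v (fun y => G y j i) p.
Proof.
by apply: near_eq_derive; apply: filterS Gs => y {1}<-; rewrite mxE.
Qed.

(** Symmetrising the symbols of the first kind in their last two indices leaves a single derivative
    of the metric. *)
Lemma metric_compatible v :
  is_derive p v G (christoffel_mx G p v *m G p + (christoffel_mx G p v *m G p)^T).
Proof.
split; first exact: diff_derivable.
rewrite deriveE// [X in 'd G p X]row_sum_delta linear_sum /=.
rewrite christoffel_mxM//; last exact: nbhs_singleton Gs.
apply/matrixP => j l; rewrite !mxE summxE -big_split /=; apply: eq_bigr => i _.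
rewrite linearZ /= mxE -mulrDr; congr (_ * _).
rewrite -deriveE// derive_mx; last exact: diff_derivable.
rewrite mxE /christoffel1 (derive_entryC _ l j) (derive_entryC _ i j).
rewrite (derive_entryC _ i l); rewrite /basis_vec; lra.
Qed.

(** Torsion-freeness, from the symmetry of [G] near [p]. *)
Lemma christoffel_mx_sym v w :
  w *m christoffel_mx G p v = v *m christoffel_mx G p w.
Proof.
apply/rowP => k; rewrite !mxE.
under eq_bigr do rewrite mxE big_distrr /=.
under [RHS]eq_bigr do rewrite mxE big_distrr /=.
rewrite exchange_big /=; apply: eq_bigr => i _; apply: eq_bigr => j _.
rewrite mulrCA; congr (_ * (_ * _)); rewrite /christoffel; congr (_ * _).
apply: eq_bigr => l _; congr (_ * _).
by rewrite (derive_entryC _ j i) [X in X - _]addrC.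
Qed.

End Metric.
End Christoffel.

(** * The second fundamental form of an immersion into a Kaehler manifold *)

Lemma unitmx_det (R : fieldType) n (A : 'M[R]_n) : A \in unitmx -> \det A != 0.
Proof. by rewrite unitmxE unitfE. Qed.

Lemma trmxD (R : nmodType) m n (A B : 'M[R]_(m, n)) : (A + B)^T = A^T + B^T.
Proof. exact: raddfD. Qed.

Section Projection.
Context {R : realType} {m n : nat}.
Implicit Types (P : 'M[R]_(m, n)) (G : 'M[R]_n).

Definition posdef G := forall v : 'rV[R]_n, v != 0 -> 0 < inner G v v.

Definition gram P G : 'M[R]_m := P *m G *m P^T.

(** The [G]-orthogonal projection onto the row space of [P], acting on row vectors from the
    right. *)
Definition tangent_proj P G : 'M[R]_n := G *m P^T *m invmx (gram P G) *m P.

(** [y *m gram P G *m y^T] is the squared length of [y *m P]. *)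
Lemma gram_inj P G (y : 'rV[R]_m) : row_free P -> posdef G ->
  y *m gram P G = 0 -> y = 0.
Proof.
move=> Pfree Gpos yg; have [//|y0] := eqVneq y 0.
have yP0 : y *m P != 0 by rewrite mulmx_free_eq0.
have := Gpos _ yP0; rewrite /inner trmx_mul.
rewrite [X in fun_of_matrix X](_ : _ = y *m gram P G *m y^T).
  by rewrite yg mul0mx mxE ltxx.
by rewrite /gram !mulmxA.
Qed.

Lemma gram_unit P G : row_free P -> posdef G -> gram P G \in unitmx.
Proof.
move=> Pfree Gpos; rewrite -row_free_unit -kermx_eq0.
apply/eqP/row_matrixP => i; rewrite row0; apply: (gram_inj Pfree Gpos).
by rewrite -row_mul mulmx_ker row0.
Qed.

Lemma gram_sym P G : G^T = G -> (gram P G)^T = gram P G.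
Proof. by move=> Gs; rewrite /gram !trmx_mul trmxK Gs mulmxA. Qed.

Lemma tangent_projK P G : gram P G \in unitmx -> P *m tangent_proj P G = P.
Proof.
move=> gu; rewrite /tangent_proj !mulmxA -[P *m G *m P^T]/(gram P G).
by rewrite mulmxV// mul1mx.
Qed.

Lemma tangent_proj_normal P G : gram P G \in unitmx ->
  tangent_proj P G *m (G *m P^T) = G *m P^T.
Proof.
move=> gu; rewrite /tangent_proj -!mulmxA [P *m (_ *m _)]mulmxA.
by rewrite -[P *m G *m P^T]/(gram P G) mulVmx// mulmx1.
Qed.

End Projection.

Section Parts.
Context {R : realType} {m n : nat}.
Variables (f : 'rV[R]_m -> 'rV[R]_n) (G : 'rV[R]_n -> 'M[R]_n) (u : 'rV[R]_m).
Hypothesis Pfree : row_free (jacobian f u).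
Hypothesis Gpos : posdef (G (f u)).
Let Pi := tangent_proj (jacobian f u) (G (f u)).

Let tangent_normal : (tangent_sp f u :&: normal_sp f G u = 0)%MS.
Proof.
apply/eqP/rowV0P => v; rewrite sub_capmx genmxE => /andP[/submxP[y ->]].
move=> /sub_kermxP; rewrite !mulmxA -(mulmxA y) -(mulmxA y) => yg.
by rewrite (gram_inj Pfree Gpos yg) mul0mx.
Qed.

Let proj_tangent (v : 'rV[R]_n) : (v *m Pi <= tangent_sp f u)%MS.
Proof. by rewrite genmxE /Pi /tangent_proj mulmxA submxMl. Qed.

Let proj_normal (v : 'rV[R]_n) : (v - v *m Pi <= normal_sp f G u)%MS.
Proof.
apply/sub_kermxP; rewrite mulmxBl -mulmxA tangent_proj_normal ?subrr//.
exact: gram_unit.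
Qed.

Lemma tangent_partE v : tangent_part f G u v = v *m Pi.
Proof.
rewrite /tangent_part -{1}(subrK (v *m Pi) v) mulmxDl.
by rewrite proj_mx_0// add0r proj_mx_id.
Qed.

Lemma normal_partE v : normal_part f G u v = v *m (1%:M - Pi).
Proof.
rewrite /normal_part -{1}(subrK (v *m Pi) v) mulmxDl.
by rewrite proj_mx_id 1?capmxC// proj_mx_0 1?capmxC// addr0 mulmxBr mulmx1.
Qed.

End Parts.

(* The local picture of an immersion into a Kaehler manifold: [f] is a
   coordinate expression of it on the open set [U]. *)
Record kaehler_immersion (R : realType) m n (f : 'rV[R]_m -> 'rV[R]_n)
    (G J : 'rV[R]_n -> 'M[R]_n) (U : set 'rV[R]_m) : Prop := KaehlerImmersion {
  ki_open : open U;
  ki_smooth : smooth_on U f;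
  ki_free : forall u, U u -> row_free (jacobian f u);
  ki_Gdiff : forall u, U u -> differentiable G (f u);
  ki_Gsym : forall u, U u -> \forall y \near f u, (G y)^T = G y;
  ki_Gpos : forall u, U u -> posdef (G (f u));
  ki_Jdiff : forall u, U u -> differentiable J (f u);
  ki_Jsq : forall u, U u -> J (f u) *m J (f u) = - 1%:M;
  ki_hermitian : forall u, U u -> J (f u) *m G (f u) *m (J (f u))^T = G (f u);
  ki_parallel : forall u v, U u -> 'D_v J (f u) =
    christoffel_mx G (f u) v *m J (f u) - J (f u) *m christoffel_mx G (f u) v
}.

Section KaehlerImmersion.
Context {R : realType} {m n : nat} (f : 'rV[R]_m -> 'rV[R]_n)
  (G J : 'rV[R]_n -> 'M[R]_n) (U : set 'rV[R]_m).
Hypothesis I : kaehler_immersion f G J U.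
Implicit Types (u x y : 'rV[R]_m) (X Y : 'rV[R]_m -> 'rV[R]_m).

Local Notation P := (jacobian f).
Local Notation g := (induced_metric f G).

(** Entry [(i, j)] is [<J e_i, e_j>] for the coordinate fields. [Tmx] and [Fmx] give the tangent and
    normal parts of [J e_i], the first in coordinates of the surface, the second as ambient
    vectors. *)
Definition kform u : 'M[R]_m := P u *m J (f u) *m G (f u) *m (P u)^T.
Definition Tmx u : 'M[R]_m := kform u *m invmx (g u).
Definition Fmx u : 'M[R]_(m, n) := P u *m J (f u) - Tmx u *m P u.
Definition normal_mx u : 'M[R]_n := 1%:M - tangent_proj (P u) (G (f u)).
(* Row [j] of [hess_mx u x] is the ambient covariant derivative of the
   coordinate field [basis_vec j] in the direction [x]. *)
Definition hess_mx u x : 'M[R]_(m, n) :=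
  'D_x P u + P u *m christoffel_mx G (f u) (push f u x).
Definition second_mx u x : 'M[R]_(m, n) := hess_mx u x *m normal_mx u.
(** Only the first term is projected: the rows of [second_mx] are normal already. *)
Definition nablaF_mx u x : 'M[R]_(m, n) :=
  second_mx u x *m J (f u) *m normal_mx u - Tmx u *m second_mx u x.

Local Notation Gam u x := (christoffel_mx G (f u) (push f u x)).

Section Point.
Variable u : 'rV[R]_m.
Hypothesis Uu : U u.

Lemma near_ki_dom : \forall w \near u, U w.
Proof. exact: open_nbhs_nbhs (conj (ki_open I) Uu). Qed.

Lemma ambient_sym : (G (f u))^T = G (f u).
Proof. exact: nbhs_singleton (ki_Gsym I Uu). Qed.

Lemma ambient_unit : G (f u) \in unitmx.
Proof.
have := gram_unit (P := 1%:M) _ (ki_Gpos I Uu).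
by rewrite row_free_unit unitmx1 /gram mul1mx trmx1 mulmx1; exact.
Qed.

Lemma induced_unit : g u \in unitmx.
Proof. exact: gram_unit (ki_free I Uu) (ki_Gpos I Uu). Qed.

Lemma induced_sym : (g u)^T = g u.
Proof. exact: gram_sym ambient_sym. Qed.

(** An isometry of square -1 is skew: replace [G] by [J G J^T] and use [J J = - 1]. *)
Lemma JG_skew : J (f u) *m G (f u) = - (G (f u) *m (J (f u))^T).
Proof.
rewrite -[in LHS](ki_hermitian I Uu) !mulmxA (ki_Jsq I Uu).
by rewrite !mulNmx mul1mx.
Qed.

Lemma kform_skew : (kform u)^T = - kform u.
Proof.
rewrite /kform !trmx_mul trmxK ambient_sym -[in RHS](mulmxA (P u)) JG_skew.
by rewrite mulmxN mulNmx opprK !mulmxA.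
Qed.

Lemma jac_normal : P u *m normal_mx u = 0.
Proof.
by rewrite /normal_mx mulmxBr mulmx1 tangent_projK ?subrr//; exact: induced_unit.
Qed.

Lemma FmxE : Fmx u = P u *m J (f u) *m normal_mx u.
Proof.
by rewrite /normal_mx mulmxBr mulmx1 /tangent_proj /Fmx /Tmx /kform !mulmxA.
Qed.

Lemma normal_mx_idem : normal_mx u *m normal_mx u = normal_mx u.
Proof.
rewrite {1}/normal_mx mulmxBl mul1mx /tangent_proj.
by rewrite -!(mulmxA _ (P u)) jac_normal !mulmx0 subr0.
Qed.

Lemma Fmx_normal : Fmx u *m normal_mx u = Fmx u.
Proof. by rewrite FmxE -(mulmxA _ (normal_mx u)) normal_mx_idem. Qed.

Lemma normal_partmx v : normal_part f G u v = v *m normal_mx u.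
Proof. by rewrite normal_partE; [|exact: (ki_free I)|exact: (ki_Gpos I)]. Qed.

Lemma FmapE y : Fmap f G J u y = y *m Fmx u.
Proof. by rewrite /Fmap normal_partmx FmxE /push !mulmxA. Qed.

Lemma is_derive_jacobian x : is_derive u x P ('D_x P u).
Proof.
by apply: derivableP; exact: derivable_jacobian (ki_open I) (ki_smooth I) Uu.
Qed.

Lemma is_derive_along (V : normedModType R) (F : 'rV[R]_n -> V) x :
  differentiable F (f u) ->
  is_derive u x (fun w => F (f w)) ('D_(push f u x) F (f u)).
Proof.
move=> dF; have df := smooth_differentiable (ki_smooth I) Uu.
by rewrite -derive_push//; exact: is_derive_comp.
Qed.

Lemma is_derive_G x : is_derive u x (fun w => G (f w))
  (Gam u x *m G (f u) + (Gam u x *m G (f u))^T).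
Proof.
have [_ <-] := metric_compatible (ki_Gdiff I Uu) (ki_Gsym I Uu) ambient_unit (push f u x).
exact: is_derive_along (ki_Gdiff I Uu).
Qed.

Lemma is_derive_J x : is_derive u x (fun w => J (f w))
  (Gam u x *m J (f u) - J (f u) *m Gam u x).
Proof.
by rewrite -(ki_parallel I _ Uu); exact: is_derive_along (ki_Jdiff I Uu).
Qed.

Lemma is_derive_induced x : is_derive u x g
  (hess_mx u x *m G (f u) *m (P u)^T + (hess_mx u x *m G (f u) *m (P u)^T)^T).
Proof.
have DP := is_derive_jacobian x.
apply: is_derive_eq (is_derive_mulmx (is_derive_mulmx DP (is_derive_G x))
  (is_derive_trmx DP)) _.
rewrite /hess_mx !trmx_mul !trmxK trmxD !trmx_mul ambient_sym.
rewrite !(mulmxDl, mulmxDr) !mulmxA !addrA.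
by rewrite [LHS]addrAC.
Qed.

(** Since [J] is parallel, its derivative is a commutator with the connection matrix: one half
    completes [hess_mx], the other cancels against the derivative of [G]. *)
Lemma is_derive_kform x : is_derive u x kform
  (hess_mx u x *m J (f u) *m G (f u) *m (P u)^T
   + P u *m J (f u) *m G (f u) *m (hess_mx u x)^T).
Proof.
have DP := is_derive_jacobian x.
apply: is_derive_eq (is_derive_mulmx (is_derive_mulmx (is_derive_mulmx DP
  (is_derive_J x)) (is_derive_G x)) (is_derive_trmx DP)) _.
rewrite /hess_mx trmxD !trmx_mul ambient_sym.
rewrite !(mulmxDl, mulmxDr, mulmxBl, mulmxBr, mulNmx, mulmxN) !mulmxA !addrA.
by rewrite -!addrA addKr [X in _ = _ + (_ + X)]addrC.
Qed.

Lemma hess_mx_sym x y : y *m hess_mx u x = x *m hess_mx u y.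
Proof.
rewrite /hess_mx !mulmxDr !mulmxA -!/(push f u _).
rewrite (derive_jacobian_sym _ _ (ki_open I) (ki_smooth I) Uu); congr (_ + _).
exact: christoffel_mx_sym (ki_Gsym I Uu) _ _.
Qed.

(** Linearity in [x] becomes visible once [hess_mx_sym] has moved [x] from the direction of
    differentiation to a left factor. *)
Lemma hess_mx_sum x : hess_mx u x = \sum_i x 0 i *: hess_mx u (basis_vec R i).
Proof.
apply/row_matrixP => j; rewrite rowE -/(basis_vec R j) hess_mx_sym.
rewrite [x in LHS]row_sum_delta mulmx_suml linear_sum /=; apply: eq_bigr => i _.
by rewrite -scalemxAl linearZ /= [in RHS]rowE -/(basis_vec R j) hess_mx_sym.
Qed.

End Point.

(** The tangential part of the ambient derivative is metric by [is_derive_induced] and torsion-free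
    by [hess_mx_sym], so uniqueness identifies it with the induced Levi-Civita connection. *)
Lemma gauss u x : U u ->
  hess_mx u x *m G (f u) *m (P u)^T = christoffel_mx g u x *m g u.
Proof.
move=> Uu; pose K i := hess_mx u (basis_vec R i) *m G (f u) *m (P u)^T.
transitivity (\sum_i x 0 i *: K i).
  rewrite hess_mx_sum// !mulmx_suml; apply: eq_bigr => i _.
  by rewrite -!scalemxAl.
apply/esym/(@christoffel_mx_koszul _ _ g u K x).
- exact: induced_sym.
- exact: induced_unit.
- by move=> i; exact: is_derive_induced.
- move=> i j; rewrite /K !rowE !mulmxA -!/(basis_vec R _).
  by rewrite hess_mx_sym.
Qed.

Lemma hess_mx_split u x : U u ->
  hess_mx u x = christoffel_mx g u x *m P u + second_mx u x.
Proof.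
move=> Uu; rewrite /second_mx /normal_mx /tangent_proj mulmxBr mulmx1 !mulmxA.
by rewrite gauss// -(mulmxA _ (g u)) mulmxV ?induced_unit// mulmx1 subrKC.
Qed.

Lemma nabla_alongE X xi u : nabla_along f G X xi u =
  'D_(X u) xi u + xi u *m Gam u (X u).
Proof. by rewrite /nabla_along christoffel_formE. Qed.

Lemma second_formE X Y u : U u -> derivable Y u (X u) ->
  second_form f G X Y u = Y u *m second_mx u (X u).
Proof.
move=> Uu /derivableP DY; rewrite /second_form normal_partmx// nabla_alongE.
have [_ ->] := is_derive_mulmx DY (is_derive_jacobian Uu (X u)).
rewrite /second_mx -addrA /push -mulmxA -mulmxDr -/(push f u _) -/(hess_mx u _).
by rewrite mulmxDl -mulmxA jac_normal// mulmx0 add0r mulmxA.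
Qed.

Lemma derivable_Tmx u x : U u -> derivable Tmx u x.
Proof.
move=> Uu; have [Dg _] := is_derive_induced Uu x.
have gu : \forall w \near u, g w \in unitmx.
  by apply: filterS (near_ki_dom Uu) => w; exact: induced_unit.
have DV := derivableP (derivable_invmx gu Dg).
by have [] := is_derive_mulmx (is_derive_kform Uu x) DV.
Qed.

(** The derivative of [Tmx] stays unevaluated: it multiplies [P], hence is tangent and disappears
    under the normal projection. *)
Lemma is_derive_Fmx u x : U u -> is_derive u x Fmx
  (hess_mx u x *m J (f u) - Tmx u *m hess_mx u x - 'D_x Tmx u *m P u
   - Fmx u *m Gam u x).
Proof.
move=> Uu; have DP := is_derive_jacobian Uu x.
have DT := derivableP (derivable_Tmx (x := x) Uu).
apply: is_derive_eq (is_deriveB (is_derive_mulmx DP (is_derive_J Uu x))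
  (is_derive_mulmx DT DP)) _.
rewrite /Fmx /hess_mx !(mulmxDl, mulmxDr, mulNmx, mulmxN) !mulmxA.
move: ('D_x P u *m _) (P u *m _ *m J _) (Tmx u *m 'D_x P u) => a b c.
move: (P u *m J _ *m _) (Tmx u *m P u *m _) (_ *m P u) => d e h.
apply/matrixP => i j; rewrite !mxE; ring.
Qed.

(** Tensoriality: the derivatives of [Y] in [D_X (F Y)] and [F (nabla_X Y)] cancel. *)
Lemma nablaFE X Y u : U u -> derivable Y u (X u) ->
  nablaF f G J X Y u = Y u *m nablaF_mx u (X u).
Proof.
move=> Uu dY; set x := X u; rewrite /nablaF /normal_connection.
rewrite nabla_alongE normal_partmx// FmapE// (FmapE Uu) /nabla christoffel_formE.
have -> : 'D_(X u) (fun w => Fmap f G J w (Y w)) u = 'D_x (fun w => Y w *m Fmx w) u.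
  by apply: near_eq_derive; apply: filterS (near_ki_dom Uu) => w Uw; rewrite FmapE.
have [_ ->] := is_derive_mulmx (derivableP dY) (is_derive_Fmx x Uu).
rewrite -/x /nablaF_mx; have jn : P u *m normal_mx u = 0 by exact: jac_normal.
have FN := Fmx_normal Uu.
(* By Gauss' formula the tangential part of [hess_mx] contributes the induced Christoffel term
   followed by [F], which is subtracted here. *)
have HE : (hess_mx u x *m J (f u) - Tmx u *m hess_mx u x) *m normal_mx u
    - christoffel_mx g u x *m Fmx u
    = second_mx u x *m J (f u) *m normal_mx u - Tmx u *m second_mx u x.
  rewrite mulmxBl -!(mulmxA (Tmx u)) -/(second_mx u x) {1}(hess_mx_split _ Uu).
  by rewrite !mulmxDl -!mulmxA (mulmxA (P u)) -FmxE// [X in X - _ - _]addrC addrAC addrK.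
rewrite -HE -addrA -(mulmxA (Y u) (Fmx u)) -mulmxDr subrK.
move: (_ *m J (f u) - _) => K.
rewrite mulmxDl -!(mulmxA _ _ (normal_mx u)) FN mulmxBl.
rewrite -(mulmxA _ (P u)) jn mulmx0 subr0.
by rewrite [RHS]mulmxBr mulmxDl opprD addrACA subrr add0r (mulmxA _ _ (Fmx u)).
Qed.

End KaehlerImmersion.

(** * Adapted frames of a surface *)

Section TwoByTwo.
Context {R : comNzRingType}.
Implicit Types (A B : 'M[R]_2).

Lemma ord2P (p : 'I_2 -> Prop) : p 0 -> p 1 -> forall i, p i.
Proof.
move=> p0 p1 [[|[|//]] lti].
- by rewrite (_ : Ordinal lti = 0)//; exact: val_inj.
- by rewrite (_ : Ordinal lti = 1)//; exact: val_inj.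
Qed.

Lemma sum2 (V : nmodType) (F : 'I_2 -> V) : \sum_i F i = F 0 + F 1.
Proof.
rewrite !big_ord_recl big_ord0 addr0; congr (_ + F _); exact: val_inj.
Qed.

Lemma mulmx2E m p (A : 'M[R]_(m, 2)) (B : 'M[R]_(2, p)) i j :
  (A *m B) i j = A i 0 * B 0 j + A i 1 * B 1 j.
Proof. by rewrite mxE sum2. Qed.

Lemma mx2P A B : A 0 0 = B 0 0 -> A 0 1 = B 0 1 -> A 1 0 = B 1 0 ->
  A 1 1 = B 1 1 -> A = B.
Proof. by move=> *; apply/matrixP; apply: ord2P; apply: ord2P. Qed.

Lemma det2E A : \det A = A 0 0 * A 1 1 - A 0 1 * A 1 0.
Proof.
rewrite (expand_det_row _ 0) sum2 /cofactor !det_mx11 !mxE /= expr0 expr1 mul1r.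
rewrite mulN1r mulrN; congr (_ * A _ _ - _ * A _ _); exact: val_inj.
Qed.

(** The quarter turn, with rows [(0, 1)] and [(-1, 0)]; over the reals it spans the skew
    matrices. *)
Definition rot : 'M[R]_2 := \matrix_(i, j) ((j%:R : R) - i%:R).

Lemma rotE : (rot 0 0 = 0) * (rot 0 1 = 1) * (rot 1 0 = -1) * (rot 1 1 = 0).
Proof. by rewrite !mxE /= !subrr subr0 sub0r. Qed.

Lemma scale_rot01 k : (k *: rot) 0 1 = k.
Proof. by rewrite mxE rotE mulr1. Qed.

Lemma rot_sq : rot *m rot = - 1%:M.
Proof. by apply: mx2P; rewrite mulmx2E !rotE !mxE /=; ring. Qed.

Lemma rot_tr : rot^T = - rot.
Proof. by apply: mx2P; rewrite mxE [RHS]mxE !rotE ?opprK ?oppr0. Qed.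

Lemma rot_congr A : A *m rot *m A^T = \det A *: rot.
Proof.
by apply: mx2P; rewrite mulmx2E !(mulmx2E A rot) [RHS]mxE !rotE det2E !mxE; ring.
Qed.

End TwoByTwo.

Lemma skew2E (R : realType) (A : 'M[R]_2) : A^T = - A -> A = A 0 1 *: rot.
Proof.
move=> /matrixP As.
have A00 := As 0 0; have A11 := As 1 1; have A01 := As 0 1.
rewrite !mxE in A00 A11 A01.
by apply: mx2P; rewrite [RHS]mxE rotE; lra.
Qed.

Section Frame.
Context {R : realType} {n : nat}.
Variables (E : 'M[R]_(2, n)) (G J : 'M[R]_n).
Hypothesis E1 : E *m G *m E^T = 1%:M.
Hypothesis Gs : G^T = G.
Hypothesis Jsq : J *m J = - 1%:M.
Hypothesis JG : J *m G = - (G *m J^T).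

(** The inner product of [J e1] with [e2]: up to sign, the cosine of the slant angle. *)
Definition frame_cos : R := (E *m J *m G *m E^T) 0 1.
Local Notation c := frame_cos.

Definition frame_normal : 'M[R]_(2, n) := E *m J - (c *: rot) *m E.
Local Notation nu := frame_normal.

Lemma frame_kform : E *m J *m G *m E^T = c *: rot.
Proof.
apply: skew2E; rewrite !trmx_mul trmxK Gs -[in RHS](mulmxA E) JG.
by rewrite mulmxN mulNmx opprK !mulmxA.
Qed.

Lemma frame_J : E *m J = nu + (c *: rot) *m E.
Proof. by rewrite subrK. Qed.

Lemma frame_normal_orth : nu *m G *m E^T = 0.
Proof.
by rewrite !mulmxBl frame_kform -!mulmxA (mulmxA E) E1 mulmx1 subrr.
Qed.

Lemma frame_normal_orthT : E *m G *m nu^T = 0.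
Proof.
by apply: trmx_inj; rewrite !trmx_mul trmxK Gs trmx0 mulmxA frame_normal_orth.
Qed.

Lemma frame_normal_J : nu *m J = - ((1 - c ^+ 2) *: E) - (c *: rot) *m nu.
Proof.
rewrite mulmxBl -mulmxA Jsq mulmxN mulmx1 -mulmxA frame_J mulmxDr opprD.
rewrite [- (_ *m nu) - _]addrC addrA; congr (_ - _).
rewrite mulmxA -scalemxAl -scalemxAr rot_sq scalerA -scalemxAl mulNmx mul1mx.
by rewrite scalerN opprK scalerBl scale1r opprB expr2 addrC.
Qed.

(** Being skew, [J] can be moved onto [E], where only the normal part [nu] pairs with the normal
    rows of [b]. *)
Lemma frame_J_normal m (b : 'M[R]_(m, n)) : b *m G *m E^T = 0 ->
  b *m J *m G *m E^T = - (b *m G *m nu^T).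
Proof.
move=> bE; rewrite -(mulmxA b) JG mulmxN mulNmx; congr (- _).
rewrite mulmxA -mulmxA -trmx_mul frame_J trmxD mulmxDr.
by rewrite trmx_mul mulmxA bE mul0mx addr0.
Qed.

(** Compute [nu *m J *m G *m E^T] twice: [frame_J_normal] gives minus the Gram matrix of [nu],
    [frame_normal_J] gives [- (1 - c ^+ 2)] times the identity. *)
Lemma frame_normal_gram : nu *m G *m nu^T = (1 - c ^+ 2)%:M.
Proof.
have := frame_J_normal frame_normal_orth; rewrite frame_normal_J => H.
apply: oppr_inj; rewrite -H !mulmxBl -!scalemxAl.
rewrite -!(mulmxA rot) frame_normal_orth mulmx0 scaler0 subr0.
by rewrite mulNmx -!scalemxAl mulNmx -scalemxAl E1 scalemx1.
Qed.

Lemma frame_J_rot m (b : 'M[R]_(m, n)) : b *m G *m E^T = 0 ->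
  b *m J *m G *m nu^T = - (b *m G *m nu^T *m (c *: rot)).
Proof.
move=> bE; rewrite -(mulmxA b) JG mulmxN mulNmx; congr (- _).
have nuJT : (nu *m J)^T = nu^T *m (c *: rot) - (1 - c ^+ 2) *: E^T.
  have trN p q (A : 'M[R]_(p, q)) : (- A)^T = - A^T by rewrite linearN.
  have trZ p q k (A : 'M[R]_(p, q)) : (k *: A)^T = k *: A^T by rewrite linearZ.
  rewrite frame_normal_J trmxD !trN trmx_mul !trZ rot_tr.
  by rewrite scalerN mulmxN opprK addrC.
by rewrite mulmxA -!(mulmxA (b *m G)) -trmx_mul nuJT mulmxBr -!scalemxAr bE scaler0 subr0.
Qed.

(** The projection has no effect against the normal rows of [nu], and [frame_J_rot] replaces [J] by
    [c *: rot], so [nabla F = 0] becomes anticommutation with [rot]. *)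
Lemma frame_nablaF (b : 'M[R]_(2, n)) : b *m G *m E^T = 0 ->
  (b *m J *m (1%:M - G *m E^T *m E) - (c *: rot) *m b) *m G *m nu^T
  = - (b *m G *m nu^T *m (c *: rot) + c *: rot *m (b *m G *m nu^T)).
Proof.
move=> bE; rewrite -!(mulmxA _ G) !mulmxBl -(mulmxA _ _ (G *m _)) mulmxBl.
rewrite mul1mx -(mulmxA _ E) !(mulmxA _ G) frame_normal_orthT mulmx0 subr0.
by rewrite mulmxA frame_J_rot// opprD !mulmxA.
Qed.

End Frame.

(** Dimension 4 enters here: [E] and [nu] together have four rows, with Gram matrix [D] invertible
    when [c ^+ 2 != 1], so they form a basis. *)
Lemma frame_complete (R : realType) k (E : 'M[R]_(2, 4)) (G J : 'M[R]_4)
    (xi : 'M[R]_(k, 4)) :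
  E *m G *m E^T = 1%:M -> G^T = G -> J *m J = - 1%:M -> J *m G = - (G *m J^T) ->
  frame_cos E G J ^+ 2 != 1 ->
  xi *m G *m E^T = 0 -> xi *m G *m (frame_normal E G J)^T = 0 -> xi = 0.
Proof.
move=> E1 Gs Jsq JG c1 xiE xinu; set nu := frame_normal E G J in xinu *.
pose Fr : 'M[R]_(2 + 2, 4) := col_mx E nu.
pose D : 'M[R]_(2 + 2) := block_mx 1%:M 0 0 (1 - frame_cos E G J ^+ 2)%:M.
have FrE : Fr *m (G *m Fr^T) = D.
  rewrite mulmxA mul_col_mx tr_col_mx mul_col_row E1 frame_normal_orthT//.
  by rewrite frame_normal_orth// frame_normal_gram.
have Du : D \in unitmx.
  rewrite unitmxE unitfE det_ublock det1 mul1r det_scalar expf_neq0//.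
  by rewrite subr_eq0 eq_sym.
have : Fr *m (G *m Fr^T *m invmx D) = 1%:M by rewrite mulmxA FrE mulmxV.
(* As [Fr] is square, its right inverse is also a left inverse. *)
move=> /(@mulmx1C _ 4 Fr (G *m Fr^T *m invmx D)) FrV.
rewrite -[xi]mulmx1 -[1%:M]FrV !mulmxA tr_col_mx mul_mx_row xiE xinu.
by rewrite row_mx0 !mul0mx.
Qed.

Lemma gram_schmidt2 (R : realType) (g : 'M[R]_2) : g^T = g -> posdef g ->
  exists S : 'M[R]_2, S *m g *m S^T = 1%:M.
Proof.
move=> /matrixP gs gpos.
have g10 : g 1 0 = g 0 1 by rewrite -[RHS]gs mxE.
have q x y : inner g (\row_i (if i == 0 then x else y)) (\row_i (if i == 0 then x else y))
    = x * x * g 0 0 + 2 * x * y * g 0 1 + y * y * g 1 1.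
  by rewrite /inner !mulmx2E !mxE /= g10; ring.
have nz (x y : R) : (x != 0) || (y != 0) ->
    (\row_i (if i == 0 then x else y) : 'rV[R]_2) != 0.
  apply: contraTneq => /rowP v0; have := v0 0; have := v0 1; rewrite !mxE /=.
  by move=> -> ->; rewrite eqxx.
have a0 : 0 < g 0 0.
  have := gpos _ (nz 1 0 _); rewrite q oner_eq0 => /(_ isT); lra.
have d0 : 0 < g 0 0 * g 1 1 - g 0 1 ^+ 2.
  have := gpos _ (nz (- g 0 1) (g 0 0) _); rewrite q (gt_eqF a0) orbT => /(_ isT).
  rewrite (_ : _ + _ = g 0 0 * (g 0 0 * g 1 1 - g 0 1 ^+ 2)); last by ring.
  by rewrite pmulr_rgt0.
set d := _ - _ in d0.
pose s := Num.sqrt (g 0 0); pose t := Num.sqrt d.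
have s2 : s * s = g 0 0 by rewrite -expr2 sqr_sqrtr// ltW.
have t2 : t * t = d by rewrite -expr2 sqr_sqrtr// ltW.
have s0 : s != 0 by rewrite gt_eqF// sqrtr_gt0.
have t0 : t != 0 by rewrite gt_eqF// sqrtr_gt0.
(* Gram-Schmidt: the first row is the first basis vector divided by its length [s]; the second is
   the orthogonal vector [(- g 0 1, g 0 0)] used above, divided by its length [s * t]. *)
exists (\matrix_(i, j) if i == 0 then (if j == 0 then s^-1 else 0)
  else (if j == 0 then - g 0 1 / (s * t) else s / t)).
have g00 : g 0 0 = s ^+ 2 by rewrite expr2.
have g11 : g 1 1 = (t ^+ 2 + g 0 1 ^+ 2) / s ^+ 2.
  by rewrite -g00 expr2 t2 /d subrK mulrAC mulfV ?mul1r// gt_eqF.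
by apply: mx2P; rewrite !mulmx2E !mxE /= g10 g11 g00; field; rewrite ?s0 ?t0.
Qed.

(** * The second fundamental form and the slant angle in an orthonormal frame *)

Section Surface.
Context {R : realType} (f : 'rV[R]_2 -> 'rV[R]_4)
  (G J : 'rV[R]_4 -> 'M[R]_4) (U : set 'rV[R]_2).
Hypothesis I : kaehler_immersion f G J U.
Implicit Types (u x y : 'rV[R]_2).

Local Notation P := (jacobian f).
Local Notation g := (induced_metric f G).
Local Notation om := (kform f G J).
Local Notation B := (second_mx f G).
Local Notation A := (nablaF_mx f G J).
Local Notation F := (Fmx f G J).

(* The square of the cosine of the slant angle. *)
Definition slant_cos2 u : R := om u 0 1 ^+ 2 / \det (g u).

Lemma posdef_induced u : U u -> posdef (g u).
Proof.
move=> Uu y y0; have yP0 : y *m P u != 0 by rewrite mulmx_free_eq0// (ki_free I).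
by have := ki_Gpos I Uu yP0; rewrite /inner trmx_mul !mulmxA.
Qed.

Lemma second_mx_sym u x y : U u -> y *m B u x = x *m B u y.
Proof. by move=> Uu; rewrite !mulmxA (hess_mx_sym I). Qed.

Lemma second_mx_orth u x : U u -> B u x *m G (f u) *m (P u)^T = 0.
Proof.
move=> Uu; rewrite /second_mx -!mulmxA.
rewrite mulmxBl mul1mx tangent_proj_normal ?subrr ?mulmx0//.
exact: gram_unit (ki_free I Uu) (ki_Gpos I Uu).
Qed.

Lemma nablaF_mx_orth u x : U u -> A u x *m G (f u) *m (P u)^T = 0.
Proof.
move=> Uu; rewrite /nablaF_mx -mulmxA mulmxBl.
rewrite -(mulmxA (Tmx _ _ _ _)) [B u x *m (G _ *m _)]mulmxA second_mx_orth//.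
rewrite mulmx0 subr0 -(mulmxA (_ *m _)) mulmxBl mul1mx tangent_proj_normal.
  by rewrite subrr mulmx0.
exact: gram_unit (ki_free I Uu) (ki_Gpos I Uu).
Qed.

Lemma trace_second_formE u : U u -> trace_second_form f G u =
  \sum_i \sum_j invmx (g u) i j *: (basis_vec R j *m B u (basis_vec R i)).
Proof.
move=> Uu; apply: eq_bigr => i _; apply: eq_bigr => j _; congr (_ *: _).
by rewrite (second_formE I)//; exact: derivable_cst.
Qed.

Section Frame.
Variables (u : 'rV[R]_2) (S : 'M[R]_2).
Hypothesis Uu : U u.
Hypothesis S1 : S *m g u *m S^T = 1%:M.

Local Notation E := (S *m P u).
Local Notation c := (frame_cos E (G (f u)) (J (f u))).
Local Notation nu := (frame_normal E (G (f u)) (J (f u))).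

Lemma frame_orthonormal : E *m G (f u) *m E^T = 1%:M.
Proof. by rewrite trmx_mul -S1 /induced_metric !mulmxA. Qed.

Let E1 := frame_orthonormal.
Let Gs := ambient_sym I Uu.
Let Jsq := ki_Jsq I Uu.
Let JG := JG_skew I Uu.

Lemma frame_unit : S \in unitmx.
Proof. by have /mulmx1_unit[] : S *m (g u *m S^T) = 1%:M by rewrite mulmxA. Qed.

Lemma frame_invmx : invmx (g u) = S^T *m S.
Proof.
have gu := induced_unit I Uu; have Su := frame_unit.
have : (g u *m S^T) *m S = 1%:M by apply: mulmx1C; rewrite mulmxA.
by rewrite -mulmxA => gSS; rewrite -[RHS](mulKmx gu) gSS mulmx1.
Qed.

Lemma frame_det : \det S ^+ 2 * \det (g u) = 1.
Proof.
have := congr1 determinant S1; rewrite !det_mulmx det_tr det1 => <-.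
by rewrite expr2; ring.
Qed.

Lemma frame_kformE : S *m om u *m S^T = c *: rot.
Proof.
by rewrite -frame_kform//; rewrite trmx_mul /kform !mulmxA.
Qed.

(** Passing to the frame multiplies [om u 0 1] by [\det S], whose square is the inverse of
    [\det (g u)]. *)
Lemma frame_slant_cos2 : slant_cos2 u = c ^+ 2.
Proof.
have cE : c = om u 0 1 * \det S.
  rewrite -[LHS]scale_rot01 -frame_kformE.
  rewrite {1}[om u](skew2E (kform_skew I Uu)) -scalemxAr -scalemxAl rot_congr.
  by rewrite scalerA scale_rot01.
have gd := unitmx_det (induced_unit I Uu).
by apply: (mulIf gd); rewrite /slant_cos2 divfK// cE exprMn -mulrA frame_det mulr1.
Qed.

Lemma frame_Tmx : S *m Tmx f G J u = (c *: rot) *m S.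
Proof. by rewrite -frame_kformE /Tmx frame_invmx !mulmxA. Qed.

Lemma frame_Fmx : S *m F u = nu.
Proof. by rewrite /frame_normal (mulmxA _ S) -frame_Tmx /Fmx mulmxBr !mulmxA. Qed.

Lemma frame_tangent_proj :
  tangent_proj (P u) (G (f u)) = G (f u) *m E^T *m E.
Proof.
rewrite /tangent_proj -[gram _ _]/(g u) frame_invmx trmx_mul.
by rewrite !mulmxA.
Qed.

Lemma frame_second_orth x : S *m B u x *m G (f u) *m E^T = 0.
Proof.
have := congr1 (fun M => S *m M *m S^T) (second_mx_orth x Uu).
by rewrite mulmx0 mul0mx trmx_mul !mulmxA.
Qed.

(** Entry [(j, k)] is [<B_x e_j, F e_k>], with the frame indexed from 0. *)
Definition frame_second x : 'M[R]_2 := S *m B u x *m G (f u) *m nu^T.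
Local Notation a := frame_second.

Lemma frame_nablaF_mx x : S *m A u x *m G (f u) *m nu^T
  = - (a x *m (c *: rot) + c *: rot *m a x).
Proof.
rewrite /a -(frame_nablaF E1 Gs Jsq JG (frame_second_orth x)).
rewrite -frame_tangent_proj (mulmxA _ S (B u x)) -frame_Tmx.
by rewrite /nablaF_mx mulmxBr !mulmxA.
Qed.

(** The rows of [A u x] are normal, and [nu] spans the normal space when [c ^+ 2 != 1], so pairing
    with [nu] loses nothing. *)
Lemma nablaF_mx_eq0 x : c ^+ 2 != 1 ->
  (A u x == 0) = (a x *m (c *: rot) + c *: rot *m a x == 0).
Proof.
move=> c1; apply/eqP/eqP => [A0|ac].
  by apply: oppr_inj; rewrite -frame_nablaF_mx A0 mulmx0 !mul0mx oppr0.
suff SA : S *m A u x = 0 by rewrite -(mulKmx frame_unit (A u x)) SA mulmx0.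
apply: (frame_complete E1 Gs Jsq JG c1).
- have := congr1 (fun M => S *m M *m S^T) (nablaF_mx_orth x Uu).
  by rewrite mulmx0 mul0mx trmx_mul !mulmxA.
- by rewrite frame_nablaF_mx ac oppr0.
Qed.

Lemma frame_second_sym j k l : a (row j S) k l = a (row k S) j l.
Proof.
have aE p q : row q (a (row p S)) = row p S *m B u (row q S) *m G (f u) *m nu^T.
  by rewrite /a !row_mul second_mx_sym.
have rowE p q (M : 'M[R]_(p, q)) i j' : M i j' = row i M 0 j' by rewrite mxE.
by rewrite rowE aE [RHS]rowE aE second_mx_sym.
Qed.

(** Since [invmx (g u)] is [S^T *m S], the trace in coordinates is a sum over the orthonormal
    frame. *)
Lemma frame_traceE : trace_second_form f G u =
  \sum_k row k S *m B u (row k S).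
Proof.
have linB x y : y *m B u x = \sum_i x 0 i *: (y *m B u (basis_vec R i)).
  rewrite second_mx_sym// [x in LHS]row_sum_delta mulmx_suml.
  apply: eq_bigr => i _; rewrite -scalemxAl -[LHS]/(_ *: (basis_vec R i *m _)).
  by rewrite second_mx_sym.
rewrite trace_second_formE// frame_invmx.
under [RHS]eq_bigr => k _.
  rewrite linB; under eq_bigr => i _ do
    rewrite [X in X *m _]row_sum_delta mulmx_suml scaler_sumr.
  over.
rewrite [RHS]exchange_big /=; apply: eq_bigr => i _.
rewrite [RHS]exchange_big /=; apply: eq_bigr => j _.
rewrite mxE scaler_suml; apply: eq_bigr => k _.
by rewrite -scalemxAl scalerA !mxE.
Qed.

Lemma frame_trace_orth : trace_second_form f G u *m G (f u) *m E^T = 0.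
Proof.
rewrite frame_traceE !mulmx_suml big1// => k _.
by rewrite -!row_mul frame_second_orth row0.
Qed.

Lemma frame_trace_normal l :
  (trace_second_form f G u *m G (f u) *m nu^T) 0 l
  = a (row 0 S) 0 l + a (row 1 S) 1 l.
Proof.
rewrite frame_traceE sum2 !mulmxDl mxE /frame_second.
have rowE p q (M : 'M[R]_(p, q)) i j : M i j = row i M 0 j by rewrite mxE.
by rewrite [X in _ = X + _]rowE [X in _ = _ + X]rowE !row_mul.
Qed.

Lemma is_derive_slant_cos2 x :
  is_derive u x slant_cos2 (2 * c * (a x 1 0 - a x 0 1)).
Proof.
(* The frame [S] is frozen at [u]: [M w] is the identity at [u] but may vary with [w], while the
   quotient [k] below still equals [slant_cos2], which a constant change of basis leaves alone. *)
pose W w := S *m om w *m S^T; pose M w := S *m g w *m S^T.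
have Su : \det S != 0 by have := frame_unit; rewrite unitmxE unitfE.
(* [K] is the tangential part of the derivative. It contributes [c] times its trace to the
   derivative of [W w 0 1] and twice its trace to that of [\det (M w)], and so drops out of the
   quotient. *)
pose K := S *m hess_mx f G u x *m G (f u) *m E^T.
have SH : S *m hess_mx f G u x = K *m E + S *m B u x.
  rewrite /second_mx /normal_mx frame_tangent_proj mulmxBr mulmx1 mulmxBr.
  by rewrite /K !mulmxA subrKC.
have DM : is_derive u x M (K + K^T).
  apply: is_derive_eq (is_derive_mulmxr S^T
    (is_derive_mulmxl S (is_derive_induced I Uu x))) _.
  rewrite mulmxDr mulmxDl /K !trmx_mul !trmxK Gs !mulmxA.
  by congr (_ + _); rewrite !mulmxA.
have DW : is_derive u x W (c *: (K *m rot + rot *m K^T) + (a x)^T - a x).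
  apply: is_derive_eq (is_derive_mulmxr S^T
    (is_derive_mulmxl S (is_derive_kform I Uu x))) _.
  transitivity (S *m hess_mx f G u x *m J (f u) *m G (f u) *m E^T
      + E *m J (f u) *m G (f u) *m (S *m hess_mx f G u x)^T).
    by rewrite mulmxDr mulmxDl !trmx_mul !mulmxA.
  have E2 : E *m G (f u) *m (S *m B u x)^T = 0.
    apply: trmx_inj; rewrite !trmx_mul !trmxK Gs trmx0 -[RHS](frame_second_orth x).
    by rewrite !trmx_mul !mulmxA.
  have aT : nu *m G (f u) *m (S *m B u x)^T = (a x)^T.
    by rewrite /frame_second [RHS]trmx_mul trmxK [in RHS]trmx_mul Gs mulmxA.
  have T1 : (K *m E + S *m B u x) *m J (f u) *m G (f u) *m E^T
      = K *m (c *: rot) - a x.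
    have bJ : S *m B u x *m J (f u) *m G (f u) *m E^T = - a x.
      by apply: frame_J_normal => //; exact: frame_second_orth.
    rewrite 3!mulmxDl bJ; congr (_ + _).
    by rewrite -frame_kform// !mulmxA.
  have T2 : E *m J (f u) *m G (f u) *m (K *m E + S *m B u x)^T
      = (c *: rot) *m K^T + (a x)^T.
    rewrite trmxD mulmxDr; congr (_ + _).
      by rewrite -frame_kform// [in LHS]trmx_mul !mulmxA.
    rewrite (frame_J E (G (f u))) 2!mulmxDl aT.
    have -> : (c *: rot) *m E *m G (f u) *m (S *m B u x)^T
        = (c *: rot) *m (E *m G (f u) *m (S *m B u x)^T) by rewrite !mulmxA.
    by rewrite E2 mulmx0 addr0.
  rewrite SH T1 T2 -scalemxAr -scalemxAl scalerDr.
  by rewrite addrACA [X in _ + X = _]addrC addrA.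
have Wu : W u = c *: rot by exact: frame_kformE.
have Mu : M u = 1%:M by exact: S1.
pose k w := W w 0 1 ^+ 2 * (M w 0 0 * M w 1 1 - M w 0 1 * M w 1 0)^-1.
apply: (@near_eq_is_derive _ _ _ k).
  apply: filterS (near_ki_dom I Uu) => w Uw; rewrite /k -det2E.
  have -> : W w 0 1 = om w 0 1 * \det S.
    rewrite /W [om w](skew2E (kform_skew I Uw)) -scalemxAr -scalemxAl rot_congr.
    by rewrite scalerA !scale_rot01.
  have gd := unitmx_det (induced_unit I Uw).
  rewrite /M !det_mulmx det_tr /slant_cos2; field; rewrite ?gd//.
have DM00 := is_derive_coord 0 0 DM; have DM11 := is_derive_coord 1 1 DM.
have DM01 := is_derive_coord 0 1 DM; have DM10 := is_derive_coord 1 0 DM.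
have DW01 := is_derive_coord 0 1 DW.
have Dd := is_deriveB (is_deriveM DM00 DM11) (is_deriveM DM01 DM10).
have d0 : M u 0 0 * M u 1 1 - M u 0 1 * M u 1 0 != 0.
  by rewrite -det2E Mu det1 oner_eq0.
have DV : is_derive u x
    (fun w => (M w 0 0 * M w 1 1 - M w 0 1 * M w 1 0)^-1) (- (2 * (K 0 0 + K 1 1))).
  split; first by apply: derivableV => //; have [] := Dd.
  rewrite deriveV//.
  have [_ ->] := Dd; rewrite Mu !mxE /= /GRing.scale /=.
  by rewrite !mulr1 mulr0 subr0 expr1n invr1; ring.
apply: is_derive_eq (is_deriveM (is_deriveX 2 DW01) DV) _.
have -> : ((fun w => W w 0 1) ^+ 2) u = c ^+ 2 by rewrite exprfctE Wu scale_rot01.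
rewrite Wu -det2E Mu det1 scale_rot01 /GRing.scale /= invr1.
have -> : (c *: (K *m rot + rot *m K^T) + (a x)^T - a x) 0 1
    = c * (K 0 0 + K 1 1) + a x 1 0 - a x 0 1.
  move: (a x) => a'; rewrite [LHS]mxE [X in X + _]mxE [X in X + _ + _]mxE.
  rewrite [(K *m _ + _) 0 1]mxE !mulmx2E !rotE !mxE; ring.
ring.
Qed.

End Frame.
End Surface.

(** Up to sign, the four entries of the anticommutator are these two quantities, each occurring
    twice. *)
Lemma anticommute_rot (R : realType) (a : 'M[R]_2) (c : R) :
  (a *m (c *: rot) + c *: rot *m a == 0)
  = (c * (a 1 0 - a 0 1) == 0) && (c * (a 0 0 + a 1 1) == 0).
Proof.
set M := _ + _.
have ME i j : M i j = c * (a *m rot + rot *m a) i j.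
  by rewrite /M -scalemxAr -scalemxAl -scalerDr mxE.
have M00 : M 0 0 = c * (a 1 0 - a 0 1).
  by rewrite ME mxE !mulmx2E !rotE; ring.
have M01 : M 0 1 = c * (a 0 0 + a 1 1).
  by rewrite ME mxE !mulmx2E !rotE; ring.
have M10 : M 1 0 = - (c * (a 0 0 + a 1 1)).
  by rewrite ME mxE !mulmx2E !rotE; ring.
have M11 : M 1 1 = c * (a 1 0 - a 0 1).
  by rewrite ME mxE !mulmx2E !rotE; ring.
apply/eqP/andP => [M0|[/eqP p /eqP q]].
  by rewrite -M00 -M01 M0 !mxE.
by apply: mx2P; rewrite ?M00 ?M01 ?M10 ?M11 ?p ?q ?oppr0 mxE.
Qed.

Lemma inner_row (R : realType) m n (G : 'M[R]_n) (N : 'M[R]_(m, n)) i :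
  (N *m G *m N^T) i i = inner G (row i N) (row i N).
Proof. by rewrite /inner -row_mul !mxE; apply: eq_bigr => j _; rewrite !mxE. Qed.

Lemma posdef_ge0 (R : realType) n (G : 'M[R]_n) v : posdef G -> 0 <= inner G v v.
Proof.
move=> Gpos; have [->|/Gpos/ltW//] := eqVneq v 0.
by rewrite /inner !mul0mx mxE.
Qed.

Lemma posdef_eq0 (R : realType) n (G : 'M[R]_n) v : posdef G ->
  inner G v v = 0 -> v = 0.
Proof.
by move=> Gpos v0; apply/eqP; apply: contra_eqT v0 => /Gpos; rewrite lt0r => /andP[].
Qed.

(** * Pointwise consequences, free of the choice of frame *)

Section SurfacePoint.
Context {R : realType} (f : 'rV[R]_2 -> 'rV[R]_4)
  (G J : 'rV[R]_4 -> 'M[R]_4) (U : set 'rV[R]_2).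
Hypothesis I : kaehler_immersion f G J U.
Variable u : 'rV[R]_2.
Hypothesis Uu : U u.

Local Notation P := (jacobian f).
Local Notation g := (induced_metric f G).
Local Notation kappa := (slant_cos2 f G J).
Local Notation A := (nablaF_mx f G J).
Local Notation trace_h := (trace_second_form f G).

Let frameP : exists S : 'M[R]_2, S *m g u *m S^T = 1%:M.
Proof. exact: gram_schmidt2 (induced_sym I Uu) (posdef_induced I Uu). Qed.

Local Notation E S := (S *m P u).
Local Notation fcos S := (frame_cos (E S) (G (f u)) (J (f u))).
Local Notation nu S := (frame_normal (E S) (G (f u)) (J (f u))).

Lemma slant_cos2_bounds : 0 <= kappa u <= 1.
Proof.
have [S S1] := frameP; rewrite (frame_slant_cos2 I Uu S1) sqr_ge0 -subr_ge0 /=.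
have N2 := frame_normal_gram (frame_orthonormal S1) (ambient_sym I Uu)
  (ki_Jsq I Uu) (JG_skew I Uu).
have -> : 1 - (fcos S) ^+ 2 = ((nu S) *m G (f u) *m (nu S)^T) 0 0 by rewrite N2 mxE.
by rewrite inner_row; exact: posdef_ge0 (ki_Gpos I Uu).
Qed.

(** [1 - c ^+ 2] is the squared length of both [F e1] and [F e2], and [G] is positive definite. *)
Lemma slant_cos2_eq1 : (kappa u == 1) = (Fmx f G J u == 0).
Proof.
have [S S1] := frameP; rewrite (frame_slant_cos2 I Uu S1).
have N2 := frame_normal_gram (frame_orthonormal S1) (ambient_sym I Uu)
  (ki_Jsq I Uu) (JG_skew I Uu).
have nuE := frame_Fmx I Uu S1.
apply/eqP/eqP => [c1|F0]; last first.
  have : ((nu S) *m G (f u) *m (nu S)^T) 0 0 = 0.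
    by rewrite -[in LHS]nuE F0 mulmx0 !mul0mx mxE.
  by rewrite N2 mxE => /eqP; rewrite subr_eq0 => /eqP.
rewrite -(mulKmx (frame_unit S1) (Fmx f G J u)) nuE.
suff -> : (nu S) = 0 by rewrite mulmx0.
apply/row_matrixP => i; rewrite row0; apply: (posdef_eq0 (ki_Gpos I Uu)).
by rewrite -inner_row N2 c1 subrr mxE mul0rn.
Qed.

Lemma slant_cos2_eq0 : (kappa u == 0) = (kform f G J u == 0).
Proof.
have gd := unitmx_det (induced_unit I Uu).
rewrite /slant_cos2 mulf_eq0 invr_eq0 (negbTE gd) orbF sqrf_eq0.
apply/eqP/eqP => [w0|->]; last by rewrite mxE.
by rewrite (skew2E (kform_skew I Uu)) w0 scale0r.
Qed.

(** The diagonal entries of the anticommutator are half the derivative of [c ^+ 2]. *)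
Lemma nablaF_mx_derive : (forall x, A u x = 0) -> forall x, is_derive u x kappa 0.
Proof.
have [S S1] := frameP => A0 x.
apply: is_derive_eq (is_derive_slant_cos2 I Uu S1 x) _.
have := frame_nablaF_mx I Uu S1 x; rewrite A0 mulmx0 !mul0mx => /esym/eqP.
by rewrite oppr_eq0 anticommute_rot -mulrA => /andP[/eqP -> _]; rewrite mulr0.
Qed.

(** For [c != 0] each matrix [a x] is symmetric with trace 0; exchanging direction and row by
    [frame_second_sym] then makes both normal components of the trace cancel. *)
Lemma nablaF_mx_minimal : (forall x, A u x = 0) -> kappa u != 0 -> kappa u != 1 ->
  trace_h u = 0.
Proof.
have [S S1] := frameP => A0; rewrite (frame_slant_cos2 I Uu S1) sqrf_eq0 => c0 c1.
pose a := frame_second f G J u S.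
have aE x : a x 1 0 = a x 0 1 /\ a x 0 0 = - a x 1 1.
  have := frame_nablaF_mx I Uu S1 x; rewrite A0 mulmx0 !mul0mx => /esym/eqP.
  rewrite -/(a x) oppr_eq0 anticommute_rot !mulf_eq0 (negbTE c0) /= => /andP[].
  by rewrite subr_eq0 addr_eq0 => /eqP -> /eqP ->.
apply: (frame_complete (frame_orthonormal S1) (ambient_sym I Uu) (ki_Jsq I Uu)
  (JG_skew I Uu) c1).
  exact: (frame_trace_orth I Uu S1).
apply/rowP; apply: ord2P; rewrite (frame_trace_normal I Uu S1) -/(a _) -/(a _) [RHS]mxE.
- have [_ ->] := aE (row 0 S); have [-> _] := aE (row 1 S).
  by rewrite /a (frame_second_sym I S Uu 0 1 1) addNr.
- have [<- _] := aE (row 0 S); have [_ E1] := aE (row 1 S).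
  by rewrite /a (frame_second_sym I S Uu 0 1 0) E1 addNr.
Qed.

Lemma nablaF_mx_sum x : A u x = \sum_i x 0 i *: A u (basis_vec R i).
Proof.
rewrite /nablaF_mx /second_mx {1 2}(hess_mx_sum I Uu) !mulmx_suml mulmx_sumr.
rewrite -sumrB; apply: eq_bigr => i _.
by rewrite -!scalemxAl -scalemxAr scalerBr.
Qed.

(** By linearity [x] may be taken in the frame. For [c = 0] both equations are trivial; otherwise
    constancy of [c ^+ 2] makes [a] symmetric, and minimality then gives trace 0. *)
Lemma nablaF_mx_eq0P : kappa u != 1 ->
  kappa u = 0 \/ trace_h u = 0 /\ (forall x, is_derive u x kappa 0) ->
  forall x, A u x = 0.
Proof.
have [S S1] := frameP; rewrite (frame_slant_cos2 I Uu S1) => c1 H x.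
suff AS k : A u (row k S) = 0.
  rewrite -(mulmxKV (frame_unit S1) x); set y := x *m _.
  rewrite nablaF_mx_sum; under eq_bigr => i _ do rewrite mxE scaler_suml.
  rewrite exchange_big /= big1// => k _.
  transitivity (y 0 k *: A u (row k S)); last by rewrite AS scaler0.
  rewrite nablaF_mx_sum scaler_sumr; apply: eq_bigr => i _.
  by rewrite scalerA [row k S 0 i]mxE.
apply/eqP; rewrite (nablaF_mx_eq0 I Uu S1)// anticommute_rot.
have [/eqP|[tr0 dk]] := H; first by rewrite sqrf_eq0 => /eqP->; rewrite !mul0r eqxx.
have [->|c0] := eqVneq (fcos S) 0; first by rewrite !mul0r eqxx.
pose a := frame_second f G J u S.
have a10 y : a y 1 0 = a y 0 1.
  have [_] := dk y; have [_ ->] := is_derive_slant_cos2 I Uu S1 y.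
  rewrite -/(a y) => /eqP; rewrite !mulf_eq0 (negbTE c0) pnatr_eq0 /= subr_eq0.
  by move/eqP.
have tr l : a (row 0 S) 0 l + a (row 1 S) 1 l = 0.
  by rewrite -(frame_trace_normal I Uu S1) tr0 !mul0mx mxE.
have asym j i l : a (row j S) i l = a (row i S) j l by exact: (frame_second_sym I S Uu).
rewrite -/(a _) a10 subrr mulr0 eqxx /= mulf_eq0 (negbTE c0) /=; apply/eqP.
move: k; apply: ord2P.
- by rewrite (asym 0 1 1) -a10 tr.
- by rewrite (asym 1 0 0) a10 tr.
Qed.

(** In the frame, [T] acts as [c *: rot] and scales every length by the absolute value of [c], while
    [J] preserves lengths; so the angle is the same for all [x]. *)
Lemma wirtinger_angleE x : x != 0 ->
  wirtinger_angle f G J u x = acos (Num.sqrt (kappa u)).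
Proof.
have [S S1] := frameP => x0; rewrite (frame_slant_cos2 I Uu S1).
have E1 := frame_orthonormal S1.
rewrite -(mulmxKV (frame_unit S1) x) in x0 *; move: (x *m _) x0 => y x0.
have y0 : y != 0 by apply: contraNneq x0 => ->; rewrite mul0mx.
rewrite /wirtinger_angle (tangent_partE (ki_free I Uu) (ki_Gpos I Uu)).
rewrite (frame_tangent_proj I Uu S1) /push; set v := _ *m J (f u).
have vE : v = y *m ((E S) *m J (f u)) by rewrite /v !mulmxA.
have n0 : 0 < (y *m y^T) 0 0.
  rewrite mxE; have /rV0Pn[i yi0] := y0; rewrite (bigD1 i)//= mxE.
  rewrite ltr_pwDl//; first by rewrite -expr2 exprn_even_gt0.
  by apply: sumr_ge0 => j _; rewrite mxE -expr2 sqr_ge0.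
have -> : Defs.gnorm (G (f u)) v = Num.sqrt ((y *m y^T) 0 0).
  rewrite /Defs.gnorm /inner; congr (Num.sqrt _).
  suff -> : v *m G (f u) *m v^T = y *m y^T by [].
  rewrite vE trmx_mul [((E S) *m _)^T]trmx_mul.
  transitivity (y *m ((E S) *m (J (f u) *m G (f u) *m (J (f u))^T) *m (E S)^T) *m y^T).
    by rewrite !mulmxA.
  by rewrite (ki_hermitian I Uu) E1 mulmx1.
have -> : Defs.gnorm (G (f u)) (v *m (G (f u) *m (E S)^T *m (E S)))
    = Num.sqrt ((fcos S) ^+ 2 * (y *m y^T) 0 0).
  rewrite /Defs.gnorm /inner; congr (Num.sqrt _).
  have -> : v *m (G (f u) *m (E S)^T *m (E S)) = y *m ((fcos S) *: rot) *m (E S).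
    rewrite -(frame_kform (E S) (ambient_sym I Uu) (JG_skew I Uu)) vE.
    by rewrite !mulmxA.
  set w := y *m _; transitivity ((w *m ((E S) *m G (f u) *m (E S)^T) *m w^T) 0 0).
    by rewrite trmx_mul !mulmxA.
  have rotT : (fcos S *: (rot : 'M[R]_2))^T = - (fcos S *: rot).
    by rewrite linearZ /= rot_tr scalerN.
  have rr : (fcos S *: rot) *m - (fcos S *: rot) = (fcos S ^+ 2)%:M.
    by rewrite mulmxN -scalemxAl -scalemxAr rot_sq scalerA -expr2 scalerN opprK scalemx1.
  rewrite E1 mulmx1 /w trmx_mul rotT -mulmxA (mulmxA (_ *: rot)) rr.
  by rewrite mul_scalar_mx -scalemxAr [LHS]mxE.
by rewrite sqrtrM ?sqr_ge0// mulfK// gt_eqF// sqrtr_gt0.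
Qed.

End SurfacePoint.

(** * Charts and connectedness *)

Lemma near_cmap (R : realType) n (T : topologicalType) (c : chart R n T) p
    (A : set T) : cdom c p -> nbhs p A ->
  \forall u \near cmap c p, exists q, [/\ cdom c q, A q & cmap c q = u].
Proof.
move=> cp nA; have icp : (cmap c @` cdom c) (cmap c p) by exists p.
have near_img : nbhs (cmap c p) (cmap c @` cdom c).
  by apply: open_nbhs_nbhs; split => //; exact: cimg_open.
have nA' : nbhs (cinv c (cmap c p)) A by rewrite cmapK.
apply: filterS2 near_img (cinv_continuous icp nA') => _ [q cq <-] /=.
by rewrite cmapK// => Aq; exists q.
Qed.

Section Charts.
Context {R : realType} {m n : nat} {M : manifold R n} (K : kaehler M)
  {N : manifold R m} (phi : N -> M).
Hypothesis phi_imm : is_immersion phi.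
Implicit Types (c : chart R m N) (d : chart R n M).

Lemma local_domP c d p : cdom c p -> cdom d (phi p) ->
  local_dom phi c d (cmap c p).
Proof. by move=> cp dp; exists p. Qed.

Lemma local_rep_cmap c d p : cdom c p -> local_rep phi c d (cmap c p) = cmap d (phi p).
Proof. by move=> cp; rewrite /local_rep cmapK. Qed.

Lemma local_rep_img c d u : local_dom phi c d u -> cimg d (local_rep phi c d u).
Proof. by move=> [p [cp dp] <-]; rewrite local_rep_cmap//; exists (phi p). Qed.

Lemma near_phi d p : cdom d (phi p) -> \forall q \near p, cdom d (phi q).
Proof.
move=> dp; apply: (phi_imm.1 p).
by apply: open_nbhs_nbhs; split => //; exact: cdom_open.
Qed.

Lemma local_dom_open c d : open (local_dom phi c d).
Proof.
rewrite openE => _ [p [cp dp] <-]; rewrite /interior /=.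
by apply: filterS (near_cmap cp (near_phi dp)) => _ [q [cq dq <-]]; exists q.
Qed.

Lemma kaehler_immersion_local c d : atlas c -> atlas d ->
  kaehler_immersion (local_rep phi c d) (kmetric K d) (kJ K d) (local_dom phi c d).
Proof.
move=> ac ad; have [Gsm Gsy Gpo _] := kmetric_riemannian K.
have [Jsm Jsq _] := kJ_almost_complex K.
have [fsm ffree] := phi_imm.2 c d ac ad.
have oimg : open (cimg d) by exact: cimg_open.
split => //.
- exact: local_dom_open.
- by move=> u /local_rep_img; apply: smooth_differentiable; exact: Gsm.
- move=> u /local_rep_img fu.
  by apply: filterS (open_nbhs_nbhs (conj oimg fu)) => y; exact: Gsy.
- by move=> u /local_rep_img fu v v0; exact: Gpo.
- by move=> u /local_rep_img; apply: smooth_differentiable; exact: Jsm.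
- by move=> u /local_rep_img; exact: Jsq.
- move=> u /local_rep_img fu; apply/matrixP => i j.
  have := k_hermitian K (basis_vec R i) (basis_vec R j) ad fu.
  have E (A : 'M[R]_n) : (basis_vec R i *m A *m (basis_vec R j)^T) 0 0 = A i j.
    by rewrite /basis_vec trmx_delta -rowE -colE !mxE.
  by rewrite /inner E trmx_mul => <-; rewrite -E !mulmxA.
- move=> u v /local_rep_img fu; set x := local_rep phi c d u in fu *.
  have dJ : differentiable (kJ K d) x by apply: smooth_differentiable fu; exact: Jsm.
  have DJ := derivableP (diff_derivable (v := v) dJ).
  apply/row_matrixP => i; rewrite !rowE; set w := delta_mx 0 i.
  (* On the constant fields [v] and [w], only the derivative of [J] and the Christoffel terms
     remain. *)
  have := @kJ_parallel _ _ _ K d _ _ _ ad oimg (@subset_refl _ _)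
    (smooth_cst _ v) (smooth_cst _ w) x fu.
  rewrite /nabla derive_cst add0r !christoffel_formE.
  have [_ ->] := is_derive_mulmxl w DJ.
  by rewrite mulmxBr !mulmxA => <-; rewrite addrK.
Qed.

End Charts.

Section Surfaces.
Context {R : realType} {M : manifold R 4} (K : kaehler M)
  {N : manifold R 2} (phi : N -> M).
Hypothesis phi_imm : is_immersion phi.
Implicit Types (c : chart R 2 N) (d : chart R 4 M).

Local Notation kappa c d := (slant_cos2 (local_rep phi c d) (kmetric K d) (kJ K d)).

(** A change of charts turns the Jacobian into [S *m jacobian f u *m A]. The laws of the metric and
    of [J] absorb [A], and [S] multiplies numerator and denominator alike by [\det S ^+ 2]. *)
Lemma slant_cos2_chart c d c' d' p : atlas c -> atlas d -> atlas c' -> atlas d' ->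
  cdom c p -> cdom d (phi p) -> cdom c' p -> cdom d' (phi p) ->
  kappa c d (cmap c p) = kappa c' d' (cmap c' p).
Proof.
move=> ac ad ac' ad' cp dp cp' dp'.
have I := kaehler_immersion_local K phi_imm ac ad.
have I' := kaehler_immersion_local K phi_imm ac' ad'.
set u := cmap c p; set u' := cmap c' p.
have Uu : local_dom phi c d u by exists p.
have Uu' : local_dom phi c' d' u' by exists p.
set f := local_rep phi c d in I *; set f' := local_rep phi c' d' in I' *.
have fu : f u = cmap d (phi p) by exact: local_rep_cmap.
have f'u' : f' u' = cmap d' (phi p) by exact: local_rep_cmap.
pose s := transition c' c; pose t := transition d d'.
have su' : s u' = u by rewrite /s /transition /u' cmapK.
have tfu : t (f u) = f' u' by rewrite /t /transition fu cmapK.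
have os : overlap c' c u' by exists p.
have ot : overlap d d' (f u) by rewrite fu; exists (phi p).
have ds : differentiable s u'.
  exact: smooth_differentiable (transition_smooth ac' ac) os.
have dt : differentiable t (f u).
  exact: smooth_differentiable (transition_smooth ad ad') ot.
have df : differentiable f u by exact: smooth_differentiable (ki_smooth I) Uu.
have f'E : \near u', t (f (s u')) = f' u'.
  have nc : nbhs p (cdom c).
    by apply: open_nbhs_nbhs; split => //; exact: cdom_open.
  apply: filterS (near_cmap cp' (filterI nc (near_phi phi_imm dp))).
  move=> _ [q [c'q [cq dq] <-]].
  by rewrite /s /t /f /f' /transition cmapK// !local_rep_cmap// cmapK.
set S := jacobian s u'; set A := jacobian t (f u).
have P'E : jacobian f' u' = S *m jacobian f u *m A.
  apply/row_matrixP => i; rewrite !rowE; set v := delta_mx 0 i.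
  have df' : differentiable f' u'.
    by exact: smooth_differentiable (ki_smooth I') Uu'.
  rewrite -deriveEjacobian//.
  have dfs : differentiable (f \o s) u'.
    apply: differentiable_comp ds _; rewrite su'; exact: df.
  have [_ D1] : is_derive u' v (fun w => t ((f \o s) w))
      ('D_('D_v (f \o s) u') t ((f \o s) u')).
    apply: is_derive_comp dfs _; rewrite /= su'; exact: dt.
  have [_ D2] : is_derive u' v (fun w => f (s w)) ('D_('D_v s u') f (s u')).
    apply: is_derive_comp ds _; rewrite su'; exact: df.
  transitivity ('D_v (fun w => t ((f \o s) w)) u').
    by apply: near_eq_derive; apply: filterS f'E => w <-.
  rewrite D1 /= su' deriveEjacobian//.
  transitivity ('D_v (fun w => f (s w)) u' *m A) => //.
  by rewrite D2 su' deriveEjacobian// deriveEjacobian// !mulmxA.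
have [_ _ _ /(_ d d' (f u) ad ad' ot)] := kmetric_riemannian K.
have [_ _ /(_ d d' (f u) ad ad' ot)] := kJ_almost_complex K.
rewrite -/t -/A tfu /= => JA GA.
have gE : induced_metric f' (kmetric K d') u'
    = S *m induced_metric f (kmetric K d) u *m S^T.
  by rewrite /induced_metric P'E GA !trmx_mul !mulmxA.
have omE : kform f' (kmetric K d') (kJ K d') u'
    = S *m kform f (kmetric K d) (kJ K d) u *m S^T.
  transitivity (S *m jacobian f u *m (A *m kJ K d' (f' u')) *m kmetric K d' (f' u')
      *m A^T *m (jacobian f u)^T *m S^T).
    by rewrite /kform P'E !trmx_mul !mulmxA.
  by rewrite -JA /kform GA !mulmxA.
have gd' := unitmx_det (induced_unit I' Uu').
have gd := unitmx_det (induced_unit I Uu).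
have Sd : \det S != 0.
  by move: gd'; rewrite gE !det_mulmx !mulf_eq0 !negb_or => /andP[/andP[]].
rewrite /slant_cos2 omE gE (skew2E (kform_skew I Uu)).
rewrite -scalemxAr -scalemxAl rot_congr scalerA !scale_rot01 !det_mulmx det_tr.
by field; rewrite ?gd ?Sd.
Qed.

(** A relation over all charts avoids choosing one at each point; [slant_valueP] and
    [slant_value_inj] make it functional. *)
Definition slant_value p r := forall c d, atlas c -> atlas d ->
  cdom c p -> cdom d (phi p) -> kappa c d (cmap c p) = r.

Lemma slant_valueP p : exists r, slant_value p r.
Proof.
have [c ac cp] := atlas_cover p; have [d ad dp] := atlas_cover (phi p).
by exists (kappa c d (cmap c p)) => c' d' *; exact: slant_cos2_chart.
Qed.

Lemma slant_value_inj p r r' : slant_value p r -> slant_value p r' -> r = r'.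
Proof.
have [c ac cp] := atlas_cover p; have [d ad dp] := atlas_cover (phi p).
by move=> /(_ c d) <- // /(_ c d) <-.
Qed.

Hypothesis dkappa : forall c d u x, atlas c -> atlas d -> local_dom phi c d u ->
  is_derive u x (kappa c d) 0.

Lemma slant_value_near p r : slant_value p r -> \forall q \near p, slant_value q r.
Proof.
move=> pr; have [c ac cp] := atlas_cover p; have [d ad dp] := atlas_cover (phi p).
have odom : open (local_dom phi c d) by exact: local_dom_open.
have ku : \forall u \near cmap c p, kappa c d u = r.
  rewrite -(pr c d)//; apply: derive0_near_cst odom (local_domP cp dp) _ => y v Uy.
  exact: dkappa.
have nk : \forall q \near p, kappa c d (cmap c q) = r.
  exact: (cmap_continuous cp ku).
have nc : \forall q \near p, cdom c q.
  by apply: open_nbhs_nbhs; split => //; exact: cdom_open.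
apply: filterS (filterI nk (filterI nc (near_phi phi_imm dp))).
move=> q [<- [cq dq]] c' d' ac' ad' cq' dq'.
by apply/esym; exact: slant_cos2_chart.
Qed.

(** The set where the value is [r] is open by [slant_value_near]; so is its complement, since
    another value [r'] also persists nearby. *)
Lemma slant_value_cst : exists r, forall p, slant_value p r.
Proof.
(* [carrier_connected] admits an empty [N], for which any [r] will do. *)
have [[p0 _]|N0] := pselect (exists p : N, True); last first.
  by exists 0 => p; case: N0; exists p.
have [r pr] := slant_valueP p0; exists r.
suff : [set p | slant_value p r] = [set: N].
  by move=> E p; have : [set: N] p by []; rewrite -E.
apply: (carrier_connected (m := N)).
- by exists p0.
- exists [set p | slant_value p r]; last by rewrite setTI.
  by rewrite openE => p /= /slant_value_near.
- exists [set p | slant_value p r]; last by rewrite setTI.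
  rewrite -openC openE => p /= npr; have [r' pr'] := slant_valueP p.
  apply: filterS (slant_value_near pr') => q qr' /= qr.
  by apply: npr; rewrite (slant_value_inj qr qr').
Qed.

End Surfaces.

(** * The classification of surfaces with parallel [F] *)

Section Classification.
Context {R : realType} {M : manifold R 4} (K : kaehler M)
  {N : manifold R 2} (phi : N -> M).
Hypothesis phi_imm : is_immersion phi.
Implicit Types (c : chart R 2 N) (d : chart R 4 M).

Local Notation fl c d := (local_rep phi c d).
Local Notation kappa c d := (slant_cos2 (fl c d) (kmetric K d) (kJ K d)).
Local Notation A c d := (nablaF_mx (fl c d) (kmetric K d) (kJ K d)).
Local Notation F c d := (Fmx (fl c d) (kmetric K d) (kJ K d)).
Local Notation om c d := (kform (fl c d) (kmetric K d) (kJ K d)).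

Let imm c d (ac : atlas c) (ad : atlas d) := kaehler_immersion_local K phi_imm ac ad.

Lemma F_parallelP : F_parallel K phi <->
  forall c d u x, atlas c -> atlas d -> local_dom phi c d u -> A c d u x = 0.
Proof.
split=> [par c d u x ac ad Uu|A0 c d U X Y ac ad oU sU sX sY u Uu].
  have I := imm ac ad; apply/row_matrixP => i; rewrite row0 rowE.
  have := par c d _ (fun=> x) (fun=> basis_vec R i) ac ad (ki_open I)
    (@subset_refl _ _) (smooth_cst _ _) (smooth_cst _ _) u Uu.
  by rewrite (nablaFE I Uu)//; exact: derivable_cst.
have I := imm ac ad.
rewrite (nablaFE I (sU _ Uu)); first by rewrite A0 ?mulmx0//; exact: sU.
by apply: diff_derivable; exact: smooth_differentiable sY Uu.
Qed.

Lemma complex_submanifoldP : complex_submanifold K phi <->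
  forall c d u, atlas c -> atlas d -> local_dom phi c d u -> F c d u = 0.
Proof.
split=> [cplx c d u ac ad Uu|F0 c d u v ac ad Uu f].
  have I := imm ac ad; rewrite FmxE; apply/row_matrixP => i.
  rewrite row0 !row_mul.
  have := cplx c d u (row i (jacobian (fl c d) u)) ac ad Uu.
  rewrite /= /tangent_sp !genmxE row_sub => /(_ isT) /submxP[y ->].
  by rewrite -mulmxA (jac_normal I Uu) mulmx0.
rewrite /tangent_sp !genmxE => /submxP[y ->]; rewrite -mulmxA.
have /eqP := F0 c d u ac ad Uu; rewrite subr_eq0 => /eqP ->.
by rewrite !mulmxA submxMl.
Qed.

Lemma totally_realP : totally_real K phi <->
  forall c d u, atlas c -> atlas d -> local_dom phi c d u -> om c d u = 0.
Proof.
split=> [treal c d u ac ad Uu|om0 c d u v ac ad Uu f].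
  apply/row_matrixP => i; rewrite row0 !row_mul.
  have := treal c d u (row i (jacobian (fl c d) u)) ac ad Uu.
  by rewrite /= /tangent_sp genmxE row_sub => /(_ isT) /sub_kermxP; rewrite mulmxA.
rewrite /tangent_sp genmxE => /submxP[y ->]; apply/sub_kermxP.
have := congr1 (mulmx y) (om0 c d u ac ad Uu).
by rewrite mulmx0 /kform !mulmxA.
Qed.

Lemma local_rep_exists (p : N) : exists c d u,
  [/\ atlas c, atlas d & local_dom phi c d u].
Proof.
have [c ac cp] := atlas_cover p; have [d ad dp] := atlas_cover (phi p).
by exists c, d, (cmap c p); split => //; exact: local_domP.
Qed.

Lemma complex_F_parallel : complex_submanifold K phi -> F_parallel K phi.
Proof.
move=> /complex_submanifoldP F0 c d U X Y ac ad oU sU _ _ u Uu.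
have I := imm ac ad; have Uu' := sU _ Uu.
have FE w y : U w -> Fmap (fl c d) (kmetric K d) (kJ K d) w y = 0.
  by move=> /sU Uw; rewrite (FmapE I Uw) F0// mulmx0.
rewrite /nablaF FE// subr0 /normal_connection (normal_partmx I Uu') nabla_alongE.
rewrite FE// mul0mx addr0.
rewrite (near_eq_derive (g := cst 0)) ?derive_cst ?mul0mx//.
by apply: filterS (open_nbhs_nbhs (conj oU Uu)) => w /FE.
Qed.

Lemma totally_real_F_parallel : totally_real K phi -> F_parallel K phi.
Proof.
move=> /totally_realP om0; apply/F_parallelP => c d u x ac ad Uu.
have I := imm ac ad.
have k0 : kappa c d u = 0 by apply/eqP; rewrite (slant_cos2_eq0 I)// om0.
by apply: (nablaF_mx_eq0P I Uu); [rewrite k0 eq_sym oner_eq0|left].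
Qed.

Lemma slant_cos2_slant r : (forall c d u, atlas c -> atlas d ->
  local_dom phi c d u -> kappa c d u = r) -> slant K phi.
Proof.
move=> kr; exists (acos (Num.sqrt r)) => c d u x ac ad Uu x0.
by rewrite (wirtinger_angleE (imm ac ad))// kr.
Qed.

(** [cos] undoes [acos] because [slant_cos2_bounds] puts the square root between 0 and 1. *)
Lemma slant_slant_cos2 : slant K phi -> exists r, forall c d u, atlas c ->
  atlas d -> local_dom phi c d u -> kappa c d u = r.
Proof.
move=> [theta slt]; exists (cos theta ^+ 2) => c d u ac ad Uu.
have I := imm ac ad; have /andP[k0 k1] := slant_cos2_bounds I Uu.
have x0 : basis_vec R (0 : 'I_2) != 0.
  by apply/eqP => /rowP/(_ 0)/eqP; rewrite !mxE !eqxx oner_eq0.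
rewrite -(slt c d u _ ac ad Uu x0) (wirtinger_angleE I)//.
rewrite acosK ?sqr_sqrtr// in_itv /= (le_trans _ (sqrtr_ge0 _)) ?lerN10//=.
by rewrite -sqrtr1 ler_wsqrtr.
Qed.

Lemma minimal_slant_F_parallel : minimal K phi -> slant K phi ->
  ~ complex_submanifold K phi -> F_parallel K phi.
Proof.
move=> min /slant_slant_cos2[r kr] ncplx; apply/F_parallelP => c d u x ac ad Uu.
have I := imm ac ad; apply: (nablaF_mx_eq0P I Uu).
  (* The value 1 at one point would be the value everywhere and make the surface complex. *)
  apply/eqP => k1; apply: ncplx; apply/complex_submanifoldP => c' d' u' ac' ad' Uu'.
  apply/eqP; rewrite -(slant_cos2_eq1 (imm ac' ad') Uu').
  by rewrite kr// -k1 (kr c d u).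
right; split; first exact: min.
move=> y; apply: near_eq_is_derive (is_derive_cst r u y).
by apply: filterS (near_ki_dom I Uu) => w Uw; rewrite (kr c d w).
Qed.

Lemma F_parallel_slant_cos2 : F_parallel K phi -> exists r, forall c d u,
  atlas c -> atlas d -> local_dom phi c d u -> kappa c d u = r.
Proof.
move=> /F_parallelP A0; have dk c d u x : atlas c -> atlas d ->
    local_dom phi c d u -> is_derive u x (kappa c d) 0.
  move=> ac ad Uu; apply: (nablaF_mx_derive (imm ac ad) Uu) => y.
  exact: A0.
have [r kr] := slant_value_cst phi_imm dk; exists r.
by move=> c d _ ac ad [p [cp dp] <-]; exact: kr.
Qed.

End Classification.

Theorem theorem3p11 (R : realType) (M : manifold R 4) (K : kaehler M)
    (N : manifold R 2) (phi : N -> M) (phi_imm : is_immersion phi) :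
  F_parallel K phi <->
  [\/ complex_submanifold K phi,
      totally_real K phi |
      minimal K phi /\ proper_slant K phi].
Proof.
split; last first.
  case=> [||[min [slt ncplx _]]].
  - exact: complex_F_parallel.
  - exact: totally_real_F_parallel.
  - exact: minimal_slant_F_parallel.
move=> par; have [r kr] := F_parallel_slant_cos2 phi_imm par.
have imm c d (ac : atlas c) (ad : atlas d) := kaehler_immersion_local K phi_imm ac ad.
have [r1|r1] := eqVneq r 1.
  apply: Or31; apply/(complex_submanifoldP K phi_imm) => c d u ac ad Uu.
  by apply/eqP; rewrite -(slant_cos2_eq1 (imm c d ac ad) Uu) (kr c d u)// r1.
have [r0|r0] := eqVneq r 0.
  apply: Or32; apply/(totally_realP K phi) => c d u ac ad Uu.
  by apply/eqP; rewrite -(slant_cos2_eq0 (imm c d ac ad) Uu) (kr c d u)// r0.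
(* An empty [N] is vacuously complex; otherwise a point serves to refute the complex and the totally
   real conditions. *)
have [[p _]|N0] := pselect (exists p : N, True); last first.
  apply: Or31 => c d u v _ _ [p _]; by case: N0; exists p.
have [c0 [d0 [u0 [ac0 ad0 Uu0]]]] := local_rep_exists phi p.
apply: Or33; split.
  move=> c d u ac ad Uu; apply: (nablaF_mx_minimal (imm c d ac ad) Uu).
  - by move=> x; move/(F_parallelP K phi_imm): par; exact.
  - by rewrite (kr c d u).
  - by rewrite (kr c d u).
split; first exact: slant_cos2_slant kr.
- move=> /(complex_submanifoldP K phi_imm)/(_ c0 d0 u0 ac0 ad0 Uu0)/eqP.
  by rewrite -(slant_cos2_eq1 (imm _ _ ac0 ad0) Uu0) (kr c0 d0 u0)// (negbTE r1).
- move=> /(totally_realP K phi)/(_ c0 d0 u0 ac0 ad0 Uu0)/eqP.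
  by rewrite -(slant_cos2_eq0 (imm _ _ ac0 ad0) Uu0) (kr c0 d0 u0)// (negbTE r0).
Qed.
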